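(* Let $N=\{1,\dots,n\}$ and $M=\{1,\dots,m\}$ with $n>m\ge 2$, and let $f:(\mathcal{R}^C)^n\to Z$ be a mechanism on the classical domain. Then $f$ is strategy-proof, individually rational, and satisfies equal treatment of equals, no wastage and no subsidy if and only if $f$ is a minimum Walrasian equilibrium price (MWEP) mechanism, i.e. $f(R)\in Z^{\min}(R)$ for every $R\in(\mathcal{R}^C)^n$.
   Context: There are $n$ agents $N=\{1,\dots,n\}$ and $m$ heterogeneous real objects $M=\{1,\dots,m\}$, with $n>m\ge 2$; $L=M\cup\{0\}$, where $0$ is the null object (no real object), which may be assigned to any number of agents. Each agent's consumption set is $L\times\mathbb{R}$; a bundle $(a,t)$ means receiving $a$ and paying $t$. A preference $R_i$ is a complete transitive relation on $L\times\mathbb{R}$ (with strict part $P_i$ and indifference $I_i$); it is classical if: (money monotonicity) $t>t'$ implies $(a,t')\,P_i\,(a,t)$ for all $a\in L$; (desirability of objects) $(a,t)\,P_i\,(0,t)$ for all $a\in M$, $t\in\mathbb{R}$; (continuity) for each $z$ the sets $\{z':z'R_iz\}$ and $\{z':zR_iz'\}$ are closed; (possibility of compensation) for each $z$ and $a\in L$ there exist $t,t'$ with $z\,R_i\,(a,t)$ and $(a,t')\,R_i\,z$. $\mathcal{R}^C$ denotes the set of all classical preferences. An object allocation is $(a_1,\dots,a_n)\in L^n$ with $a_i=a_j$ for $i\neq j$ only if $a_i=a_j=0$; an allocation is $z=((a_1,t_1),\dots,(a_n,t_n))$ whose objects form an object allocation; $Z$ is the set of allocations. A mechanism is $f:(\mathcal{R}^C)^n\to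 Z$, written $f_i(R)=(a_i(R),t_i(R))$. Properties: strategy-proof: $f_i(R_i,R_{-i})\,R_i\,f_i(R_i',R_{-i})$ for all $i,R_i,R_i',R_{-i}$; individually rational: $f_i(R)\,R_i\,(0,0)$ for all $i,R$; equal treatment of equals: $R_i=R_j$ implies $f_i(R)\,I_i\,f_j(R)$; no wastage: for every $R$ and every $a\in M$ some $i$ has $a_i(R)=a$; no subsidy: $t_i(R)\ge 0$ for all $i,R$. A price vector is $p\in\mathbb{R}_+^{L}$ with $p_0=0$; the demand set is $D(R_i,p)=\{a\in L:(a,p_a)\,R_i\,(b,p_b)\ \forall b\in L\}$. An object allocation $(a_1,\dots,a_n)$ and price vector $p$ form a Walrasian equilibrium at $R$ if $a_i\in D(R_i,p)$ for all $i$ and $p_a=0$ for every $a\in M$ assigned to no agent. For classical profiles, Walrasian equilibrium price vectors exist and there is a unique componentwise minimum one, $p^{\min}(R)$. $Z^{\min}(R)$ is the set of allocations $((a_i,p^{\min}_{a_i}(R)))_{i\in N}$ such that $(a_1,\dots,a_n)$ together with $p^{\min}(R)$ is a Walrasian equilibrium at $R$. *)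

(* Defs.v *)
From mathcomp Require Import all_boot.
From Stdlib Require Import Reals.
Set Implicit Arguments. Unset Strict Implicit. Unset Printing Implicit Defensive.
Local Open Scope R_scope.

(* Objects: L = M ∪ {0} is 'I_m.+1, with ord0 the null object and 1..m real objects. *)
Definition obj (m : nat) := 'I_m.+1.
Definition null {m : nat} : obj m := ord0.
Definition bundle (m : nat) := (obj m * R)%type.
Definition pref (m : nat) := bundle m -> bundle m -> Prop.

Definition strictP m (P : pref m) z z' := P z z' /\ ~ P z' z.
Definition indiffP m (P : pref m) z z' := P z z' /\ P z' z.

(* Classical preferences. L carries the discrete topology, so closedness in
   L x R amounts to closedness of every slice {t | (a,t) ...} in R. *)
Definition classical m (P : pref m) : Prop :=
  (forall z z', P z z' \/ P z' z) /\
  (forall z1 z2 z3, P z1 z2 -> P z2 z3 -> P z1 z3) /\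
  (forall (a : obj m) (t t' : R), t > t' -> strictP P (a, t') (a, t)) /\
  (forall (a : obj m) (t : R), a <> null -> strictP P (a, t) (null, t)) /\
  (forall (z : bundle m) (a : obj m),
      closed_set (fun t => P (a, t) z) /\ closed_set (fun t => P z (a, t))) /\
  (forall (z : bundle m) (a : obj m), exists t t', P z (a, t) /\ P (a, t') z).

Definition cpref (m : nat) := {P : pref m | classical P}.
Definition profile (n m : nat) := 'I_n -> cpref m.

Definition object_allocation n m (x : 'I_n -> obj m) : Prop :=
  forall i j : 'I_n, i <> j -> x i = x j -> x i = null.

Definition allocation (n m : nat) :=
  {z : 'I_n -> bundle m | object_allocation (fun i => fst (z i))}.

Definition mechanism (n m : nat) := profile n m -> allocation n m.

Definition fout n m (f : mechanism n m) (R0 : profile n m) (i : 'I_n) : bundle m :=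
  proj1_sig (f R0) i.
Definition prf n m (R0 : profile n m) (i : 'I_n) : pref m := proj1_sig (R0 i).

Definition update n m (R0 : profile n m) (i : 'I_n) (Ri : cpref m) : profile n m :=
  fun j => if j == i then Ri else R0 j.

Definition strategy_proof n m (f : mechanism n m) : Prop :=
  forall (R0 : profile n m) (i : 'I_n) (Ri' : cpref m),
    prf R0 i (fout f R0 i) (fout f (update R0 i Ri') i).

Definition individually_rational n m (f : mechanism n m) : Prop :=
  forall (R0 : profile n m) (i : 'I_n), prf R0 i (fout f R0 i) (null, 0).

Definition equal_treatment n m (f : mechanism n m) : Prop :=
  forall (R0 : profile n m) (i j : 'I_n), R0 i = R0 j ->
    indiffP (prf R0 i) (fout f R0 i) (fout f R0 j).

Definition no_wastage n m (f : mechanism n m) : Prop :=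
  forall (R0 : profile n m) (a : obj m), a <> null ->
    exists i : 'I_n, fst (fout f R0 i) = a.

Definition no_subsidy n m (f : mechanism n m) : Prop :=
  forall (R0 : profile n m) (i : 'I_n), 0 <= snd (fout f R0 i).

Definition price_vector m (p : obj m -> R) : Prop :=
  p null = 0 /\ forall a, 0 <= p a.

Definition in_demand m (P : pref m) (p : obj m -> R) (a : obj m) : Prop :=
  forall b : obj m, P (a, p a) (b, p b).

Definition walrasian_eq n m (R0 : profile n m) (x : 'I_n -> obj m) (p : obj m -> R) : Prop :=
  object_allocation x /\ price_vector p /\
  (forall i, in_demand (prf R0 i) p (x i)) /\
  (forall a : obj m, a <> null -> (forall i, x i <> a) -> p a = 0).

Definition WE_price n m (R0 : profile n m) (p : obj m -> R) : Prop :=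
  exists x, walrasian_eq R0 x p.

Definition min_WE_price n m (R0 : profile n m) (p : obj m -> R) : Prop :=
  WE_price R0 p /\ forall q, WE_price R0 q -> forall a, p a <= q a.

Definition in_Zmin n m (R0 : profile n m) (z : 'I_n -> bundle m) : Prop :=
  exists (p : obj m -> R) (x : 'I_n -> obj m),
    min_WE_price R0 p /\ walrasian_eq R0 x p /\ forall i, z i = (x i, p (x i)).

(* Main.v *)
Require Import Defs.
From Stdlib Require Import Reals Lra.
From mathcomp Require Import all_boot fingroup perm boolp zify.
Set Implicit Arguments. Unset Strict Implicit. Unset Printing Implicit Defensive.
Local Open Scope R_scope.

(** Sufficiency is a counting argument: no deviator can lower the price of the object
    it gets, because every set Z of objects is demanded by more than #|Z| agents at
    the minimum prices p.

    Necessity: first, every agent is at least as well off under f as in any Walrasian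
    equilibrium, so f charges at most p, and it suffices to show that it never charges
    less. Suppose h gets b for less than p b. Replace the preference of h by a
    classical, non-quasilinear one for which b is above all else at the current
    payment but hardly acceptable beyond it, while a second object r is wanted at any
    moderate price. Then h still gets b from f, but not at the minimum prices. If the
    pairs (b, r) chosen so far form a forest on the objects, some agent not yet
    replaced could now also get an object for less than its equilibrium price, and
    can be replaced in turn. After m replacements the replaced agents hold all the
    objects, and equal treatment of equals gives a contradiction by letting agents
    report the preferences of others. *)

(** * Utility representation of classical preferences *)

Lemma closed_approx (D : R -> Prop) (t : R) :
  closed_set D -> (forall e, 0 < e -> exists2 s, Rabs (s - t) < e & D s) -> D t.
Proof.
move=> cD Dt; apply: contrapT => nDt.
have [[d d0] dP] := cD t nDt; have [s st Ds] := Dt d d0.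
exact: (dP s st).
Qed.

(** The utility of [z] is minus the payment [t] at which [(null, t)] is indifferent to [z]. This
    payment is the supremum of those at which the null object is weakly better; closedness gives
    both comparisons at the supremum. *)
Lemma util_exists m (P : cpref m) : exists u : obj m -> R -> R,
  (forall a s b t, proj1_sig P (a, s) (b, t) <-> u b t <= u a s) /\
  (forall t, u null t = - t).
Proof.
case: P => P /= [tot [tr [mon [des [clo cmp]]]]].
have monw a s t : s <= t -> P (a, s) (a, t).
  case=> [st|->]; first by have [] := mon a t s st.
  by case: (tot (a, t) (a, t)).
have eqv z : exists t, P (null, t) z /\ P z (null, t).
  have [t1 [t2 [zt1 t2z]]] := cmp z null.
  pose E t := P (null, t) z.
  have bE : bound E.
    exists t1 => t Et; apply: Rnot_lt_le => lt.
    have [_ []] := mon null t t1 lt.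
    exact: (tr _ _ _ Et zt1).
  have [t0 [ub lub]] := completeness E bE (ex_intro _ t2 t2z).
  exists t0; split.
    apply: (closed_approx (proj1 (clo z null))) => e e0.
    apply: contrapT => nex; have := lub (t0 - e).
    suff H : is_upper_bound E (t0 - e) by move=> /(_ H); lra.
    move=> t Et; apply: Rnot_lt_le => lt; apply: nex; exists t => //.
    have := ub t Et; rewrite /Rabs; case: Rcase_abs; lra.
  apply: (closed_approx (proj2 (clo z null))) => e e0.
  exists (t0 + e / 2); first by rewrite /Rabs; case: Rcase_abs; lra.
  case: (tot (null, t0 + e / 2) z) => // /ub; lra.
have [u uP] : exists u, forall z, P (null, u z) z /\ P z (null, u z).
  by exists (fun z => projT1 (cid (eqv z))) => z; case: (cid _).
exists (fun a s => - u (a, s)); split => [a s b t|t]; last first.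
  have [H1 H2] := uP (null, t).
  have [lt|[->//|lt]] := Rtotal_order (u (null, t)) t.
    by have [_ []] := mon null _ _ lt.
  by have [_ []] := mon null _ _ lt.
have [A1 A2] := uP (a, s); have [B1 B2] := uP (b, t); split=> H.
  apply: Rnot_lt_le => lt; have lt' : u (b, t) < u (a, s) by lra.
  have [_ []] := mon null _ _ lt'.
  exact: (tr _ _ _ A1 (tr _ _ _ H B2)).
exact: (tr _ _ _ A2 (tr _ _ _ (monw _ _ _ (Ropp_le_cancel _ _ H)) B1)).
Qed.

Definition util m (P : cpref m) : obj m -> R -> R := projT1 (cid (util_exists P)).
Arguments util : simpl never.

Lemma utilP m (P : cpref m) a s b t :
  proj1_sig P (a, s) (b, t) <-> util P b t <= util P a s.
Proof. by rewrite /util; case: cid => u [H _] /=. Qed.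

Lemma util_null m (P : cpref m) t : util P null t = - t.
Proof. by rewrite /util; case: cid => u [_ H] /=. Qed.

Lemma util_lt m (P : cpref m) a s t : s < t -> util P a t < util P a s.
Proof.
move=> st; have [_ [_ [mon _]]] := proj2_sig P.
have [_] := mon a t s st; rewrite utilP; lra.
Qed.

Lemma util_le m (P : cpref m) a s t : s <= t -> util P a t <= util P a s.
Proof. by case=> [/util_lt-/(_ m P a)|->]; lra. Qed.

Lemma util_le_inv m (P : cpref m) a s t : util P a t <= util P a s -> s <= t.
Proof. by move=> h; apply: Rnot_lt_le => /util_lt-/(_ m P a); lra. Qed.

Lemma util_lt_inv m (P : cpref m) a s t : util P a t < util P a s -> s < t.
Proof. by move=> h; apply: Rnot_le_lt => /util_le-/(_ m P a); lra. Qed.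

Lemma util_desirable m (P : cpref m) a t : a <> null -> - t < util P a t.
Proof.
move=> a0; have [_ [_ [_ [des _]]]] := proj2_sig P.
have [_] := des a t a0; rewrite utilP util_null; lra.
Qed.

Lemma util_le_bound m (P : cpref m) a : exists t, util P a t <= 0.
Proof.
have [_ [_ [_ [_ [_ cmp]]]]] := proj2_sig P.
have [t [_ [H _]]] := cmp (null, 0) a.
by exists t; move: H; rewrite utilP util_null; lra.
Qed.

Lemma util_cont m (P : cpref m) a t e : 0 < e -> exists2 d, 0 < d &
  forall s, Rabs (s - t) < d -> Rabs (util P a s - util P a t) < e.
Proof.
move=> e0; have [_ [_ [_ [_ [clo _]]]]] := proj2_sig P.
have [[d1 d10] H1] : neighbourhood
    (complementary (fun s => proj1_sig P (a, s) (null, - (util P a t + e)))) t.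
  by apply: (proj1 (clo _ a)); rewrite /complementary utilP util_null; lra.
have [[d2 d20] H2] : neighbourhood
    (complementary (fun s => proj1_sig P (null, - (util P a t - e)) (a, s))) t.
  by apply: (proj2 (clo _ a)); rewrite /complementary utilP util_null; lra.
exists (Rmin d1 d2); first exact: Rmin_pos.
move=> s st; have := H1 s; have := H2 s.
rewrite /disc /complementary !utilP !util_null /=.
have := Rmin_l d1 d2; have := Rmin_r d1 d2 => m1 m2 h2 h1.
have {}h1 := h1 ltac:(lra); have {}h2 := h2 ltac:(lra).
by apply: Rabs_def1; lra.
Qed.

Lemma util_le_limit m (P : cpref m) a s b t :
  (forall e, 0 < e -> exists s' t', [/\ Rabs (s' - s) < e, Rabs (t' - t) < e
     & util P b t' <= util P a s']) ->
  util P b t <= util P a s.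
Proof.
move=> H; apply: Rnot_lt_le => lt.
have e0 : 0 < (util P b t - util P a s) / 2 by lra.
have [d1 d10 H1] := util_cont P a s e0; have [d2 d20 H2] := util_cont P b t e0.
have [s' [t' [hs ht h]]] := H _ (Rmin_pos _ _ d10 d20).
have := Rmin_l d1 d2; have := Rmin_r d1 d2 => m1 m2.
have /Rabs_def2 := H1 s' ltac:(lra); have /Rabs_def2 := H2 t' ltac:(lra); lra.
Qed.

(* Utility representation of the preferences built below: on object a it has
   slope - lam a up to the willingness to pay v a, and slope -1 beyond it. *)
Definition kink m (v lam : obj m -> R) (z : bundle m) : R :=
  Rmax (lam z.1 * (v z.1 - z.2)) (v z.1 - z.2).

Lemma kink_classical m (v lam : obj m -> R) :
  v null = 0 -> lam null = 1 -> (forall a, a <> null -> 0 < v a) ->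
  (forall a, 1 <= lam a) ->
  classical (fun z z' => kink v lam z' <= kink v lam z).
Proof.
move=> v0 l0 vp l1.
have lt_kink a s t : s < t -> kink v lam (a, t) < kink v lam (a, s).
  move=> st; rewrite /kink /=.
  have h := Rmult_lt_compat_l (lam a) (v a - t) (v a - s).
  have := l1 a => la; have {}h := h ltac:(lra) ltac:(lra).
  by apply: Rmax_lub_lt; [apply: Rlt_le_trans (Rmax_l _ _)|apply: Rlt_le_trans (Rmax_r _ _)]; lra.
(* The Lipschitz constant [lam a] supplies the radii in the closedness proofs below. *)
have lip a s t : s <= t -> kink v lam (a, s) - kink v lam (a, t) <= lam a * (t - s).
  move=> st; have la := l1 a; rewrite /kink /=.
  have h1 := Rmax_l (lam a * (v a - t)) (v a - t).
  have h2 := Rmax_r (lam a * (v a - t)) (v a - t).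
  have h3 : 0 <= (lam a - 1) * (t - s) by apply: Rmult_le_pos; lra.
  suff : Rmax (lam a * (v a - s)) (v a - s)
      <= lam a * (t - s) + Rmax (lam a * (v a - t)) (v a - t) by lra.
  by apply: Rmax_lub; lra.
split; first by move=> z z'; lra.
split; first by move=> z1 z2 z3; lra.
split; first by move=> a t t' /lt_kink-/(_ a) h; split; lra.
split.
  move=> a t /vp va; suff : kink v lam (null, t) < kink v lam (a, t) by rewrite /strictP; lra.
  rewrite /kink /= v0 l0; have := Rmax_r (lam a * (v a - t)) (v a - t).
  by rewrite (Rmax_left (1 * _)); lra.
split.
  move=> z a; split=> t; rewrite /complementary => /Rnot_le_lt h.
    have d0 : 0 < (kink v lam z - kink v lam (a, t)) / lam a.
      by apply: Rdiv_lt_0_compat; have := l1 a; lra.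
    exists (mkposreal _ d0) => s; rewrite /disc /= => /Rabs_def2 [_ h2].
    apply: Rlt_not_le; have [st|ts] := Rle_or_lt s t; last first.
      by have := lt_kink a _ _ ts; lra.
    have := lip a _ _ st; have la := l1 a.
    have : lam a * (t - s) < lam a * ((kink v lam z - kink v lam (a, t)) / lam a).
      by apply: Rmult_lt_compat_l; lra.
    have -> : lam a * ((kink v lam z - kink v lam (a, t)) / lam a)
       = kink v lam z - kink v lam (a, t) by field; lra.
    lra.
  have d0 : 0 < (kink v lam (a, t) - kink v lam z) / lam a.
    by apply: Rdiv_lt_0_compat; have := l1 a; lra.
  exists (mkposreal _ d0) => s; rewrite /disc /= => /Rabs_def2 [h1 _].
  apply: Rlt_not_le; have [ts|st] := Rle_or_lt t s; last first.
    by have := lt_kink a _ _ st; lra.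
  have := lip a _ _ ts; have la := l1 a.
  have : lam a * (s - t) < lam a * ((kink v lam (a, t) - kink v lam z) / lam a).
    by apply: Rmult_lt_compat_l; lra.
  have -> : lam a * ((kink v lam (a, t) - kink v lam z) / lam a)
     = kink v lam (a, t) - kink v lam z by field; lra.
  lra.
move=> z a; have la := l1 a; set w := kink v lam z.
exists (v a + Rabs w), (v a - Rabs w); rewrite /kink /=.
have := Rle_abs w; have := Rle_abs (- w); rewrite Rabs_Ropp => w1 w2.
have p : 0 <= (lam a - 1) * Rabs w by apply: Rmult_le_pos; [lra|exact: Rabs_pos].
split; first by apply: Rmax_lub; lra.
by apply: Rle_trans (Rmax_r _ _); lra.
Qed.

(** On the null object [kink] is minus the payment, which is also the normalisation of [util]; hence
    the two coincide. *)
Lemma kink_util m (v lam : obj m -> R) :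
  v null = 0 -> lam null = 1 -> (forall a, a <> null -> 0 < v a) ->
  (forall a, 1 <= lam a) ->
  exists P : cpref m, forall a s, util P a s = kink v lam (a, s).
Proof.
move=> v0 l0 vp l1; exists (exist _ _ (kink_classical v0 l0 vp l1)) => a s.
set P := exist _ _ _.
set w := kink v lam (a, s).
have e : kink v lam (null, - w) = w by rewrite /kink /= v0 l0 Rmax_left; lra.
have h1 : proj1_sig P (a, s) (null, - w) by rewrite /= e /w; lra.
have h2 : proj1_sig P (null, - w) (a, s) by rewrite /= e /w; lra.
by move: h1 h2; rewrite !utilP util_null; lra.
Qed.

(** * Existence of tight prices *)

Lemma finite_upper (T : finType) (P : T -> R -> Prop) :
  (forall t, exists b, forall c, b <= c -> P t c) ->
  exists b, forall c, b <= c -> forall t, P t c.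
Proof.
move=> H; suff [b bP] : exists b, forall c, b <= c -> forall t, t \in enum T -> P t c.
  by exists b => c bc t; apply: (bP c bc); rewrite mem_enum.
elim: (enum T) => [|t s [b IH]]; first by exists 0.
have [b' b'P] := H t; exists (Rmax b b') => c bc t'.
have l := Rmax_l b b'; have r := Rmax_r b b'.
by rewrite inE => /orP[/eqP->|/IH]; [apply: b'P|apply]; lra.
Qed.

Lemma finite_lower (T : finType) (P : T -> R -> Prop) :
  (forall t, exists2 e, 0 < e & forall d, 0 < d <= e -> P t d) ->
  exists2 e, 0 < e & forall d, 0 < d <= e -> forall t, P t d.
Proof.
move=> H.
suff [e e0 eP] : exists2 e, 0 < e & forall d, 0 < d <= e -> forall t, t \in enum T -> P t d.
  by exists e => // d de t; apply: (eP d de); rewrite mem_enum.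
elim: (enum T) => [|t s [e e0 IH]]; first by exists 1 => //; lra.
have [e' e'0 e'P] := H t; exists (Rmin e e'); first exact: Rmin_pos.
move=> d de t'; have l := Rmin_l e e'; have r := Rmin_r e e'.
by rewrite inE => /orP[/eqP->|/IH]; [apply: e'P|apply]; lra.
Qed.

(** Pigeonhole: if each [t] failed below some threshold, all would fail below the least one. *)
Lemma finite_limit (T : finType) (Q : T -> R -> Prop) :
  (forall t e e', e <= e' -> Q t e -> Q t e') ->
  (forall e, 0 < e -> exists t, Q t e) -> exists t, forall e, 0 < e -> Q t e.
Proof.
move=> mono H; apply: contrapT => nex.
have [t|e e0 eP] := @finite_lower T (fun t d => ~ Q t d).
  apply: contrapT => nt; apply: nex; exists t => e e0.
  apply: contrapT => nQ; apply: nt; exists e => // d de.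
  by apply: contra_not nQ; apply: mono; lra.
by have [t] := H e e0; apply: eP; lra.
Qed.

Lemma finite_argmax (T : finType) (t0 : T) (g : T -> R) :
  exists t, forall t', g t' <= g t.
Proof.
suff [t tP] : exists t, forall t', t' \in enum T -> g t' <= g t.
  by exists t => t'; apply: tP; rewrite mem_enum.
elim: (enum T) => [|u s [t IH]]; first by exists t0.
have [h|h] := Rle_or_lt (g u) (g t); [exists t|exists u] => t';
  rewrite inE => /orP[/eqP->|/IH]; lra.
Qed.

(** One coordinate of Bolzano-Weierstrass: [y] is the limit superior of [g] as [e] tends to 0. *)
Lemma cluster1 (X : Type) (K : R) (Q : R -> X -> Prop) (g : X -> R) :
  (forall e e' x, e <= e' -> Q e x -> Q e' x) ->
  (forall e x, Q e x -> 0 <= g x <= K) ->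
  (forall e, 0 < e -> exists x, Q e x) ->
  exists y, forall e, 0 < e -> exists2 x, Q e x & Rabs (g x - y) < e.
Proof.
move=> mono bnd H.
pose E y := forall e, 0 < e -> exists2 x, Q e x & y <= g x.
have bE : bound E.
  by exists K => y /(_ 1 ltac:(lra)) [x /bnd]; lra.
have E0 : E 0 by move=> e /H[x Qx]; exists x => //; have := bnd _ _ Qx; lra.
have [y [ub lub]] := completeness E bE (ex_intro _ 0 E0).
exists y => e e0.
have [y' Ey' yy'] : exists2 y', E y' & y - e < y'.
  apply: contrapT => nex; suff : y <= y - e by lra.
  by apply: lub => z Ez; apply: Rnot_lt_le => lt; apply: nex; exists z.
have [e1 e10 e1P] : exists2 e1, 0 < e1 & forall x, Q e1 x -> g x < y + e / 2.
  apply: contrapT => nex; suff /ub : E (y + e / 2) by lra.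
  move=> d d0; apply: contrapT => nex'; apply: nex; exists d => // x Qx.
  by apply: Rnot_le_lt => le; apply: nex'; exists x.
have [x Qx xy] := Ey' _ (Rmin_pos _ _ e0 e10).
have l := Rmin_l e e1; have r := Rmin_r e e1.
have h := e1P x (mono _ _ _ r Qx).
by exists x; [apply: mono Qx|apply: Rabs_def1; lra].
Qed.

Lemma cluster (T : finType) (K : R) (Q : R -> (T -> R) -> Prop) :
  (forall e e' p, e <= e' -> Q e p -> Q e' p) ->
  (forall e p, Q e p -> forall a, 0 <= p a <= K) ->
  (forall e, 0 < e -> exists p, Q e p) ->
  exists q, forall e, 0 < e -> exists2 p, Q e p & forall a, Rabs (p a - q a) < e.
Proof.
move=> mono bnd H.
suff [q qP] : exists q, forall e, 0 < e -> exists2 p, Q e p &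
    forall a, a \in enum T -> Rabs (p a - q a) < e.
  by exists q => e /qP[p Qp pq]; exists p => // a; apply: pq; rewrite mem_enum.
elim: (enum T) => [|a s [q IH]].
  by exists (fun=> 0) => e /H[p]; exists p.
pose Q' e p := Q e p /\ forall a, a \in s -> Rabs (p a - q a) < e.
have [|||y yP] := @cluster1 _ K Q' (fun p => p a).
- by move=> e e' p ee' [/mono-/(_ _ ee') ? h]; split=> // b /h; lra.
- by move=> e p [/bnd].
- by move=> e /IH[p Qp h]; exists p.
exists (fun b => if b == a then y else q b) => e /yP[p [Qp h] pa]; exists p => // b.
by rewrite inE; case: eqP => [->|_] //= /h.
Qed.

(** * Overdemand and the ascending auction *)

Definition demanders n m (R0 : profile n m) (p : obj m -> R) (Z : {set obj m}) :
  {set 'I_n} := [set k | `[< exists2 a, a \in Z & in_demand (prf R0 k) p a >]].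

(** The Hall-type condition through which minimality of Walrasian prices is used;
    [min_WE_price_tight] shows the equivalence. *)
Definition tight n m (R0 : profile n m) (p : obj m -> R) : Prop :=
  WE_price R0 p /\ forall Z : {set obj m}, Z != set0 -> null \notin Z ->
    (#|Z| < #|demanders R0 p Z|)%N.

Lemma demandersP n m (R0 : profile n m) p (Z : {set obj m}) k :
  reflect (exists2 a, a \in Z & in_demand (prf R0 k) p a) (k \in demanders R0 p Z).
Proof. by rewrite inE; apply: asboolP. Qed.

Lemma in_demandP n m (R0 : profile n m) i p a :
  in_demand (prf R0 i) p a <->
  forall b, util (R0 i) b (p b) <= util (R0 i) a (p a).
Proof. by split=> H b; [apply/utilP; apply: H|apply/(utilP (R0 i)); apply: H]. Qed.

Lemma alloc_inj n m (x : 'I_n -> obj m) i j :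
  object_allocation x -> x i <> null -> x i = x j -> i = j.
Proof. by move=> al xi0 e; apply: contrapT => ij; apply: xi0 (al _ _ ij e). Qed.

Lemma alloc_card n m (x : 'I_n -> obj m) (S : {set 'I_n}) (Z : {set obj m}) :
  object_allocation x -> null \notin Z -> (forall i, i \in S -> x i \in Z) ->
  (#|S| <= #|Z|)%N.
Proof.
move=> al Z0 SZ; rewrite -(@card_in_imset _ _ x S).
  by apply/subset_leq_card/subsetP => _ /imsetP[i iS ->]; exact: SZ.
move=> i j iS jS; apply: alloc_inj al _ => xi; move: (SZ i iS).
by rewrite xi (negbTE Z0).
Qed.

Lemma alloc_null n m (x : 'I_n -> obj m) (S : {set 'I_n}) : object_allocation x ->
  (m < #|S|)%N -> exists2 i, i \in S & x i = null.
Proof.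
move=> al mS; apply: contrapT => nex.
suff : (#|S| <= #|[set~ null : obj m]|)%N by rewrite cardsC1 card_ord /= leqNgt mS.
apply: alloc_card al _ _; first by rewrite !inE eqxx.
by move=> i iS; rewrite !inE; apply/eqP => xi; apply: nex; exists i.
Qed.

(** As [m < n], some agent gets the null object and would rather take [a] for free. *)
Lemma WE_price_pos n m (R0 : profile n m) x p a : (m < n)%N ->
  walrasian_eq R0 x p -> a <> null -> 0 < p a.
Proof.
move=> mn [xal [[p0 pp] [dem uns]]] a0.
have [|i _ xi] := @alloc_null _ _ x setT xal; first by rewrite cardsT card_ord.
have /in_demandP/(_ a) := dem i; rewrite xi p0 util_null => h.
by case: (pp a) => // e; have := util_desirable (R0 i) (p a) a0; lra.
Qed.

(* Approximate equilibria of the ascending auction with bid increment e: k a counts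
   the bids received by a, so that e * k a is its price and a new bidder must pay
   e * (k a).+1. The last clause records the bidder displaced by the last bid on Z. *)
Definition next_price m (e : R) (k : obj m -> nat) (a : obj m) : R :=
  if a == null then 0 else e * INR (k a).+1.

Definition auction_state n m (R0 : profile n m) e (x : 'I_n -> obj m) (k : obj m -> nat) :=
  [/\ object_allocation x,
      k null = 0%N /\ (forall a, a <> null -> (forall i, x i <> a) -> k a = 0%N),
      forall i, x i <> null -> forall b,
        util (R0 i) b (next_price e k b) <= util (R0 i) (x i) (e * INR (k (x i))) &
      forall Z : {set obj m}, Z != set0 -> null \notin Z ->
        (forall a, a \in Z -> (2 <= k a)%N) ->
        exists i a, [/\ a \in Z, x i \notin Z & forall b,
          util (R0 i) b (next_price e k b) <= util (R0 i) a (e * (INR (k a) - 1))]].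

Lemma next_price_null m e (k : obj m -> nat) : next_price e k null = 0.
Proof. by rewrite /next_price eqxx. Qed.

Lemma auction_step n m (R0 : profile n m) e x k : 0 < e ->
  auction_state R0 e x k ->
  (forall j, x j = null -> forall b, util (R0 j) b (next_price e k b) <= 0) \/
  exists x' k', auction_state R0 e x' k' /\ \sum_a k' a = (\sum_a k a).+1.
Proof.
move=> e0 [xal [k0 uns] dem lst].
have [|nall] := EM (forall j, x j = null -> forall b, util (R0 j) b (next_price e k b) <= 0).
  by left.
right.
have [j [xj [b0 b0P]]] : exists j, x j = null /\ exists b, 0 < util (R0 j) b (next_price e k b).
  apply: contrapT => nex; apply: nall => j xj b; apply: Rnot_lt_le => lt.
  by apply: nex; exists j; split=> //; exists b.
(* The unassigned agent [j] bids on its favourite object [c] and displaces the holder of [c], if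
   any. *)
have [c cP] := finite_argmax null (fun b => util (R0 j) b (next_price e k b)).
have c0 : c <> null.
  by move=> c0; have := cP b0; rewrite c0 next_price_null util_null; lra.
pose k' b := if b == c then (k b).+1 else k b.
pose x' i := if i == j then c else if x i == c then null else x i.
have k'k b : next_price e k b <= next_price e k' b.
  rewrite /next_price /k'; case: ifP => _; first lra.
  case: ifP => _; last lra.
  by apply: Rmult_le_compat_l; [lra|rewrite !S_INR; lra].
exists x', k'; split; last first.
  rewrite (bigD1 c) //= [in RHS](bigD1 c) //= /k' eqxx addSn; congr (_ + _).+1%N.
  by apply: eq_bigr => b /negbTE ->.
split.
- move=> i i'; rewrite /x'.
  case: (i =P j) => [->|_]; case: (i' =P j) => [->|_] //.
  + by case: eqP => // h _ h'; case: h.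
  + by case: eqP => // h _ h'; case: h.
  + by case: (x i =P c) => // _; case: (x i' =P c) => // _; exact: xal.
- split; first by rewrite /k'; case: eqP => // h; case: c0.
  move=> a a0 na; rewrite /k'; case: eqP => [ac|ac].
    by case: (na j); rewrite /x' eqxx.
  apply: uns => // i xi; apply: (na i); rewrite /x'; case: eqP => [ij|_].
    by case: a0; rewrite -xi ij.
  by case: eqP => // xc; case: ac; rewrite -xi.
- move=> i x'i b; have := k'k b => /(@util_le _ (R0 i) b).
  move: x'i; rewrite /x'; case: eqP => [->|_] x'i.
    have -> : e * INR (k' c) = next_price e k c.
      by rewrite /next_price /k' eqxx; case: eqP.
    by have := cP b; lra.
  move: x'i; case: eqP => // xic xi.
  have -> : k' (x i) = k (x i) by rewrite /k'; case: eqP.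
  by have := dem i xi b; lra.
(* If [c] is in [Z], the witness is the displaced holder, content with [c] at the price before this
   bid. Otherwise the old witness for [Z] remains one, since next prices only rise. *)
move=> Z Zne Z0 Z2; have [cZ|cZ] := boolP (c \in Z).
  have kc : k c <> 0%N by have := Z2 c cZ; rewrite /k' eqxx; lia.
  have [i xi] : exists i, x i = c.
    by apply: contrapT => nex; apply: kc; apply: uns => // i xi; apply: nex; exists i.
  exists i, c; split => //.
    rewrite /x' xi eqxx; case: eqP => // ij.
    by case: c0; rewrite -xi ij.
  move=> b; have xi0 : x i <> null by rewrite xi.
  have := dem i xi0 b; have := util_le (R0 i) b (k'k b); rewrite xi.
  rewrite /k' eqxx S_INR; have -> : INR (k c) + 1 - 1 = INR (k c) by lra.
  lra.
have [i [a [aZ xZ h]]] : exists i a, [/\ a \in Z, x i \notin Z & forall b,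
    util (R0 i) b (next_price e k b) <= util (R0 i) a (e * (INR (k a) - 1))].
  apply: lst => // a aZ; have := Z2 a aZ; rewrite /k'; case: eqP => // ac.
  by rewrite ac (negbTE cZ) in aZ.
exists i, a; split => //.
  by rewrite /x'; case: eqP => // _; case: eqP.
move=> b; have := h b; have := util_le (R0 i) b (k'k b).
have -> : k' a = k a by rewrite /k'; case: eqP => // ac; rewrite -ac aZ in cZ.
lra.
Qed.

Definition wtp_lt m (K : R) (P : cpref m) : Prop :=
  forall a s, 0 <= util P a s -> s < K.

Lemma profile_wtp_lt n m (R0 : profile n m) :
  exists2 K, 1 < K & forall i, wtp_lt K (R0 i).
Proof.
have [|K KP] := @finite_upper _ (fun ia : 'I_n * obj m => fun c =>
    forall s, 0 <= util (R0 ia.1) ia.2 s -> s < c).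
  move=> [i a] /=; have [t tP] := util_le_bound (R0 i) a.
  exists (t + 1) => c tc s s0; suff : s <= t by lra.
  by apply: (@util_le_inv _ (R0 i) a); lra.
have l := Rmax_l K 2; have r := Rmax_r K 2.
by exists (Rmax K 2); [lra|move=> i a s; exact: (KP _ l (i, a))].
Qed.

Definition auction_stop n m (R0 : profile n m) e (x : 'I_n -> obj m) (k : obj m -> nat) :=
  auction_state R0 e x k /\
  forall i b, util (R0 i) b (next_price e k b) <= util (R0 i) (x i) (e * INR (k (x i))).

Lemma auction_price_bound n m (R0 : profile n m) K e x k : 1 < K ->
  (forall i, wtp_lt K (R0 i)) -> auction_state R0 e x k ->
  forall a, e * INR (k a) < K.
Proof.
move=> K1 bK [xal [k0 uns] dem _] a.
have [|ua] := EM (exists i, x i = a /\ a <> null).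
  move=> [i [xi a0]]; apply: (bK i a); rewrite -xi in a0 *.
  by have := dem i a0 null; rewrite next_price_null util_null; lra.
suff -> : k a = 0%N by rewrite Rmult_0_r; lra.
have [->//|a0] := EM (a = null).
by apply: uns => // i xi; apply: ua; exists i.
Qed.

(** An endless auction would add one bid per step, although all prices stay below the bound [K] on
    the willingness to pay. *)
Lemma auction_ends n m (R0 : profile n m) e : 0 < e ->
  exists x k, auction_stop R0 e x k.
Proof.
move=> e0; apply: contrapT => nend.
have [K K1 bK] := profile_wtp_lt R0.
have run t : exists x k, auction_state R0 e x k /\ \sum_a k a = t.
  elim: t => [|t [x [k [st kt]]]].
    exists (fun=> null), (fun=> 0%N); split; last by rewrite big1.
    split => //; move=> Z /set0Pn[a aZ] _ /(_ a aZ) //.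
  have [stop|[x' [k' [st' k't]]]] := auction_step e0 st; last first.
    by exists x', k'; rewrite k't kt.
  case: nend; exists x, k; split=> // i b.
  have [xi|xi] := EM (x i = null); last by case: st => _ _ dem _; exact: dem.
  case: st => _ [k0 _] _ _; rewrite xi k0 Rmult_0_r util_null Ropp_0.
  exact: stop.
have [N NP] := INR_unbounded (K / e).
have [x [k [st kN]]] := run (m.+1 * N).+1.
have kaN a : (k a <= N)%N.
  have h := auction_price_bound K1 bK st a.
  suff : INR (k a) < INR N by move/INR_lt; lia.
  apply: Rlt_trans NP; apply: (Rmult_lt_reg_l e) => //.
  by have -> : e * (K / e) = K by field; lra.
have : (\sum_a k a <= \sum_(a : obj m) N)%N by apply: leq_sum => a _.
by rewrite kN sum_nat_const card_ord ltnn.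
Qed.

(** The prices are a limit of final auction prices as the increment tends to 0, along auctions that
    all end in the same object allocation [x]. *)
Lemma exists_tight n m (R0 : profile n m) : (m < n)%N -> exists p, tight R0 p.
Proof.
move=> mn; have [K K1 bK] := profile_wtp_lt R0.
pose Q (x : {ffun 'I_n -> obj m}) e (p : obj m -> R) := exists d k,
  [/\ 0 < d <= e, auction_stop R0 d x k & forall a, p a = d * INR (k a)].
have Qmono x e e' p : e <= e' -> Q x e p -> Q x e' p.
  by move=> ee' [d [k [de st pk]]]; exists d, k; split=> //; lra.
have [x xP] : exists x, forall e, 0 < e -> exists p, Q x e p.
  apply: finite_limit => [x e e' ee' [p /(Qmono _ _ _ _ ee')]|e e0]; first by exists p.
  have [x [k st]] := auction_ends R0 e0.
  exists (finfun x), (fun a => e * INR (k a)), e, k; split=> //; first lra.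
  by have -> : finfun x = x :> (_ -> _) by apply/funext => i; rewrite ffunE.
have Qbnd e p : Q x e p -> forall a, 0 <= p a <= K.
  move=> [d [k [d0 [st _] pk]]] a; rewrite pk; split.
    by apply: Rmult_le_pos; [lra|exact: pos_INR].
  by have := auction_price_bound K1 bK st a; lra.
have [q qP] := cluster (Qmono x) Qbnd xP.
have [xal [k0 _]] : object_allocation x /\ (q null = 0 /\ True).
  split; first by have [p [d [k [_ [[] ]]]]] := xP 1 ltac:(lra).
  split => //; apply: cond_eq => e /qP[p [d [k [_ [[_ [k0 _] _ _] _] pk]]]] /(_ null).
  by rewrite pk k0 Rmult_0_r Rabs_minus_sym.
have we : walrasian_eq R0 x q.
  split => //; split.
    split => // a; apply: Rnot_lt_le => qa.
    have [|p /Qbnd/(_ a) pa /(_ a)/Rabs_def2] := qP (- q a); lra.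
  split.
    move=> i; apply/in_demandP => b; apply: util_le_limit => e e0.
    have [|p [d [k [d0 [st stop] pk]]] pq] := qP (e / 2); first lra.
    exists (d * INR (k (x i))), (next_price d k b); split => //.
      by have := pq (x i); rewrite pk => /Rabs_def2 h; apply: Rabs_def1; lra.
    have := pq b; rewrite pk /next_price; case: eqP => [->|_] /Rabs_def2 h.
      by rewrite k0; apply: Rabs_def1; lra.
    by rewrite S_INR; apply: Rabs_def1; lra.
  move=> a a0 ua; apply: cond_eq => e /qP[p [d [k [_ [[_ [_ uns] _ _] _] pk]]]] /(_ a).
  by rewrite pk uns // Rmult_0_r Rabs_minus_sym.
exists q; split; first by exists x.
move=> Z /set0Pn[a1 a1Z] Z0.
have Zreal a : a \in Z -> a <> null by move=> aZ a0; rewrite -a0 aZ in Z0.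
have qpos a : a \in Z -> 0 < q a by move/Zreal; exact: WE_price_pos we.
(* Close enough to the limit, every object of [Z] has received the two bids that the last clause of
   [auction_state] asks for. *)
have [|e0 e00 e0P] := @finite_lower (obj m) (fun a d => a \in Z -> 3 * d < q a).
  move=> a; have [aZ|/negP aZ] := boolP (a \in Z); last by exists 1 => //; lra.
  by have := qpos a aZ; exists (q a / 4) => [|d]; lra.
(* The last bidder displaced on [Z], the same [i] along the limit, demands an object of [Z] at [q]
   but holds none in [x]. Together with the holders of [Z] this gives more than [#|Z|] demanders. *)
pose W (ia : 'I_n * obj m) e := exists d k, [/\ 0 < d <= e,
  forall a, Rabs (d * INR (k a) - q a) < e, ia.2 \in Z, x ia.1 \notin Z &
  forall b, util (R0 ia.1) b (next_price d k b)
     <= util (R0 ia.1) ia.2 (d * (INR (k ia.2) - 1))].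
have [[i a] /= iaP] : exists ia, forall e, 0 < e -> W ia e.
  apply: finite_limit => [ia e e' ee' [d [k [d0 kq aZ xZ h]]]|e e1].
    by exists d, k; split=> //; [lra|move=> b; have := kq b; lra].
  have m0 := Rmin_pos _ _ e1 e00; have ml := Rmin_l e e0; have mr := Rmin_r e e0.
  have [p [d [k [d0 [[_ _ _ lst] _] pk]]] pq] := qP _ m0.
  have [||i [a [aZ xZ h]]] := lst Z _ Z0; first by apply/set0Pn; exists a1.
    move=> a aZ; have := pq a; rewrite pk => /Rabs_def2 [_ h].
    have := e0P _ (conj m0 mr) a aZ => h'.
    suff : INR 1 < INR (k a) by move/INR_lt; lia.
    apply: (Rmult_lt_reg_l d); rewrite ?[INR 1]/=; lra.
  exists (i, a), d, k; split => //; first lra.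
  by move=> b; have := pq b; rewrite pk; lra.
have [d1 [k1 [_ _ aZ xZ _]]] := iaP 1 ltac:(lra).
have demi : in_demand (prf R0 i) q a.
  apply/in_demandP => b; apply: util_le_limit => e e1.
  have [|d [k [d0 kq _ _ h]]] := iaP (e / 2); first lra.
  exists (d * (INR (k a) - 1)), (next_price d k b); split => //.
    by have := kq a => /Rabs_def2 h'; apply: Rabs_def1; lra.
  have := kq b; rewrite /next_price; case: eqP => [->|_] /Rabs_def2 h'.
    by rewrite k0; apply: Rabs_def1; lra.
  by rewrite S_INR; apply: Rabs_def1; lra.
have [_ [_ [dem uns]]] := we.
pose S := [set k | x k \in Z].
have ZS : (#|Z| <= #|S|)%N.
  have -> : Z = x @: S.
    apply/setP => b; apply/idP/imsetP => [bZ|[k]]; last by rewrite inE => ? ->.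
    suff [k xk] : exists k, x k = b by exists k; rewrite ?inE ?xk.
    apply: contrapT => nex; have := qpos b bZ; rewrite uns; first lra.
      exact: Zreal.
    by move=> k xk; apply: nex; exists k.
  exact: leq_imset_card.
apply: (@leq_trans #|i |: S|); first by rewrite cardsU1 inE xZ add1n ltnS.
apply/subset_leq_card/subsetP => k; rewrite !inE => /orP[/eqP->|xk]; apply/asboolP.
  by exists a.
by exists (x k).
Qed.

(** * Comparison of tight prices *)

(** Taking [a] already makes the agent better off at [q] than at [p], so whatever it demands at [q]
    has become cheaper. *)
Lemma cheaper_demand m (P : cpref m) p q a e :
  in_demand (proj1_sig P) p a -> in_demand (proj1_sig P) q e -> q a < p a -> q e < p e.
Proof.
move=> pa qe qpa; apply: (@util_lt_inv _ P e).
have /utilP h1 := pa e; have /utilP h2 := qe a; have := util_lt P a qpa; lra.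
Qed.

Definition below m (q p : obj m -> R) : {set obj m} := [set a | `[< q a < p a >]].

Lemma belowP m (q p : obj m -> R) a : reflect (q a < p a) (a \in below q p).
Proof. by rewrite inE; apply: asboolP. Qed.

Lemma below_null m (q p : obj m -> R) : price_vector p -> price_vector q ->
  null \notin below q p.
Proof. by move=> [p0 _] [q0 _]; apply/belowP; rewrite p0 q0; lra. Qed.

(** By [cheaper_demand], each agent demanding an object of [below q p] at [p] holds one of them in
    [x]; if the set were nonempty, tightness would give too many such agents. *)
Lemma tight_min n m (R0 : profile n m) p q :
  tight R0 p -> WE_price R0 q -> forall a, p a <= q a.
Proof.
move=> [[x0 [_ [pp _]]] tp] [x [xal [pq [dem _]]]] a; apply: Rnot_lt_le => qpa.
have /tp/(_ (below_null pp pq)) : below q p != set0 by apply/set0Pn; exists a; apply/belowP.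
apply/negP; rewrite -leqNgt; apply: (alloc_card xal (below_null pp pq)) => i /demandersP[b].
by move=> /belowP qpb bd; apply/belowP; apply: (@cheaper_demand _ (R0 i)) bd (dem i) qpb.
Qed.

Lemma min_WE_price_tight n m (R0 : profile n m) p : (m < n)%N ->
  min_WE_price R0 p <-> tight R0 p.
Proof.
move=> mn; split=> [[we pmin]|tp]; last by split; [exact: tp.1|move=> q; exact: tight_min].
have [q tq] := exists_tight R0 mn; suff -> : p = q by [].
by apply/funext => a; apply: Rle_antisym; [apply: pmin; exact: tq.1|exact: tight_min we a].
Qed.

(** The count of [tight_min] survives a misreport of [i]: if [q (x i) < p (x i)], then [i] too holds
    an object of [below q p]. *)
Lemma tight_deviation n m (R0 R1 : profile n m) i p x q :
  tight R0 p -> walrasian_eq R1 x q -> (forall k, k <> i -> R1 k = R0 k) ->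
  p (x i) <= q (x i).
Proof.
move=> [[x0 [_ [pp _]]] tp] [xal [pq [dem _]]] R10; apply: Rnot_lt_le => qpi.
have /tp/(_ (below_null pp pq)) : below q p != set0.
  by apply/set0Pn; exists (x i); apply/belowP.
apply/negP; rewrite -leqNgt; apply: (alloc_card xal (below_null pp pq)) => k /demandersP[b].
move=> /belowP qpb bd; apply/belowP; have [->//|ki] := EM (k = i).
apply: (@cheaper_demand _ (R0 k)) bd _ qpb.
by have := dem k; rewrite /prf R10.
Qed.

Lemma quasilinear m (v : obj m -> R) : v null = 0 -> (forall a, a <> null -> 0 < v a) ->
  exists P : cpref m, forall a s, util P a s = v a - s.
Proof.
move=> v0 vp; have [|P Pu] := @kink_util m v (fun=> 1) v0 erefl vp; first by move=> a; lra.
by exists P => a s; rewrite Pu /kink /= Rmax_left; lra.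
Qed.

Lemma update_same n m (R0 : profile n m) i P : update R0 i P i = P.
Proof. by rewrite /update eqxx. Qed.

Lemma update_other n m (R0 : profile n m) i P k : k <> i -> update R0 i P k = R0 k.
Proof. by rewrite /update; case: eqP. Qed.

(* If the agents in Y demand only objects in Z and need all of them, an agent j
   outside Y who insists on an object c of Z raises its price. *)
Lemma hall_price_rise n m (R0 : profile n m) p j c (Y : {set 'I_n}) (Z : {set obj m}) :
  (m < n)%N -> tight R0 p -> null \notin Z -> c \in Z -> j \notin Y ->
  (forall l a, l \in Y -> in_demand (prf R0 l) p a -> a \in Z) -> (#|Z| <= #|Y|)%N ->
  exists Rj q, tight (update R0 j Rj) q /\ p c < q c.
Proof.
move=> mn tp Z0 cZ jY YZ ZY.
have [x [xal [pp [dem _]]]] := tp.1.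
have c0 : c <> null by move=> c0; rewrite -c0 cZ in Z0.
have pc : 0 <= p c by case: pp.
(* As long as [c] costs at most [p c] it yields at least 2, and everything else at most 1. *)
have [||Rj Rju] := @quasilinear m (fun a => if a == null then 0 else if a == c then p c + 2 else 1).
- by rewrite eqxx.
- by move=> a /eqP/negbTE->; case: ifP => _; lra.
have [q tq] := exists_tight (update R0 j Rj) mn; exists Rj, q; split => //.
apply: Rnot_le_lt => qpc.
have weq := tq.1; have [x' wex'] := weq; have [x'al [pq [dem' _]]] := wex'.
have onlyc a : in_demand (prf (update R0 j Rj) j) q a -> a = c.
  rewrite /prf update_same => ad; apply: contrapT => ac.
  have /utilP := ad c; rewrite !Rju eqxx (negbTE (introN eqP c0)) (negbTE (introN eqP ac)).
  by case: ifP => _; have := (proj2 pq) a; lra.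
have x'j : x' j = c by apply: onlyc; exact: dem'.
have cp : p c <= q c.
  by rewrite -x'j; apply: (tight_deviation tp wex') => k; exact: update_other.
have qp a : q a <= p a.
  apply: Rnot_lt_le => pqa; have n0 := below_null pq pp.
  have /tq.2/(_ n0) : below p q != set0 by apply/set0Pn; exists a; apply/belowP.
  apply/negP; rewrite -leqNgt; apply: (alloc_card xal n0) => k /demandersP[b /belowP pqb bd].
  have kj : k <> j by move=> kj; rewrite kj in bd; have := onlyc _ bd => bc; rewrite bc in pqb; lra.
  apply/belowP; rewrite /prf update_other // in bd.
  exact: (@cheaper_demand _ (R0 k)) bd (dem k) pqb.
have M0 := below_null pp pq.
have cM : c \notin below q p by apply/belowP; lra.
pose E := below q p :\: Z; pose D := demanders R0 p E :\ j.
have ED : (#|E| <= #|D|)%N.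
  have [->|E0] := eqVneq E set0; first by rewrite cards0.
  have : (#|E| < #|demanders R0 p E|)%N by apply: tp.2 => //; rewrite inE (negbTE M0) andbF.
  by rewrite /D; have := cardsD1 j (demanders R0 p E); case: (j \in _) => /=; lia.
have YD : [disjoint Y & D].
  apply/pred0P => k /=; apply/negP => /andP[kY]; rewrite inE => /andP[_ /demandersP[b bE bd]].
  by move: bE; rewrite inE (YZ k b kY bd).
(* In [x'] the agents of [Y] and [D] hold objects of [Z :|: E] other than [c], which [j] holds; this
   is one object too few. *)
have : (#|Y :|: D| <= #|(Z :|: below q p) :\ c|)%N.
  apply: (alloc_card x'al); first by rewrite in_setD1 in_setU (negbTE Z0) (negbTE M0) andbF.
  have sub k : k \in Y :|: D -> x' k \in Z :|: below q p.
    have d' : k <> j -> in_demand (prf R0 k) q (x' k).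
      by move=> kj; have := dem' k; rewrite /prf update_other.
    rewrite !in_setU in_setD1 => /orP[kY|/andP[/eqP kj kE]].
      have /d' xd : k <> j by move=> kj; rewrite -kj kY in jY.
      have [//|/negP x'Z] := boolP (x' k \in Z).
      apply/belowP; apply: (@util_lt_inv _ (R0 k) (x' k)).
      have /utilP h1 := xd (x k); have h2 := util_le (R0 k) (x k) (qp (x k)).
      suff : util (R0 k) (x' k) (p (x' k)) < util (R0 k) (x k) (p (x k)) by lra.
      apply: Rnot_le_lt => h; apply: x'Z; apply: (YZ k) => //; apply/in_demandP => b.
      by have /in_demandP/(_ b) := dem k; lra.
    have /demandersP[b bE bd] := kE.
    move: bE; rewrite in_setD => /andP[_ /belowP qpb]; apply/orP; right; apply/belowP.
    exact: (@cheaper_demand _ (R0 k)) bd (d' kj) qpb.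
  move=> k kYD; rewrite in_setD1 sub // andbT; apply/eqP => x'k.
  have kj : k = j by apply: (alloc_inj x'al); rewrite ?x'k ?x'j.
  by move: kYD; rewrite kj in_setU (negbTE jY) in_setD1 eqxx.
have -> : (Z :|: below q p) = Z :|: E by apply/setP => a; rewrite !inE; case: (a \in Z).
have := cardsD1 c (Z :|: E); rewrite in_setU cZ add1n => e1 e2.
have e3 : #|Z :|: E| = (#|Z| + #|E|)%N.
  rewrite cardsU; suff -> : Z :&: E = set0 by rewrite cards0 subn0.
  by apply/setP => a; rewrite !inE; case: (a \in Z); rewrite ?andbF.
have e4 : #|Y :|: D| = (#|Y| + #|D|)%N.
  by have := leq_card_setU Y D; rewrite YD => -[_ /eqP].
by have := leq_add ZY ED; rewrite -e4 -e3 e1 leqNgt ltnS e2.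
Qed.

(** * Comparison of f with Walrasian equilibria *)

Definition desirable n m (f : mechanism n m) : Prop :=
  strategy_proof f /\ individually_rational f /\ equal_treatment f /\
  no_wastage f /\ no_subsidy f.

Definition uval m (P : cpref m) (z : bundle m) : R := util P z.1 z.2.

Lemma uvalP m (P : cpref m) z z' : proj1_sig P z z' <-> uval P z' <= uval P z.
Proof. by case: z z' => [a s] [b t]; exact: utilP. Qed.

Lemma fout_alloc n m (f : mechanism n m) R0 :
  object_allocation (fun i => (fout f R0 i).1).
Proof. exact: (proj2_sig (f R0)). Qed.

Lemma fout_sp n m (f : mechanism n m) R0 i P : desirable f ->
  uval (R0 i) (fout f (update R0 i P) i) <= uval (R0 i) (fout f R0 i).
Proof. by case=> sp _; apply/uvalP; exact: sp. Qed.

Lemma update_update n m (R0 : profile n m) i P Q :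
  update (update R0 i P) i Q = update R0 i Q.
Proof. by apply/funext => k; rewrite /update; case: eqP. Qed.

Lemma update_id n m (R0 : profile n m) i : update R0 i (R0 i) = R0.
Proof. by apply/funext => k; rewrite /update; case: eqP => [->|]. Qed.

Lemma fout_sp_to n m (f : mechanism n m) R0 i P : desirable f ->
  uval P (fout f R0 i) <= uval P (fout f (update R0 i P) i).
Proof.
move=> df; have := @fout_sp _ _ f (update R0 i P) i (R0 i) df.
by rewrite update_update update_id update_same.
Qed.

Lemma fout_ir n m (f : mechanism n m) R0 i : desirable f ->
  0 <= uval (R0 i) (fout f R0 i).
Proof.
move=> [_ [ir _]]; have /uvalP := ir R0 i.
by rewrite /uval /= util_null Ropp_0.
Qed.

Lemma fout_ete n m (f : mechanism n m) R0 i j : desirable f -> R0 i = R0 j ->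
  uval (R0 i) (fout f R0 i) = uval (R0 i) (fout f R0 j).
Proof.
by move=> [_ [_ [ete _]]] /ete [/uvalP h1 /uvalP h2]; apply: Rle_antisym.
Qed.

Lemma fout_holder n m (f : mechanism n m) R0 a : desirable f -> a <> null ->
  exists i, (fout f R0 i).1 = a.
Proof. by move=> [_ [_ [_ [nw _]]]]; exact: nw. Qed.

Lemma fout_pay n m (f : mechanism n m) R0 i : desirable f -> 0 <= (fout f R0 i).2.
Proof. by move=> [_ [_ [_ [_ ns]]]]; exact: ns. Qed.

Lemma uval_pos_real m (P : cpref m) z : 0 <= z.2 -> 0 < uval P z -> z.1 <> null.
Proof. by rewrite /uval => z2 zp z1; rewrite z1 util_null in zp; lra. Qed.

(* If k does worse than in the equilibrium (x, q), replace its preference by one that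
   only wants x k, for slightly more than q (x k). Then k cannot get x k, and ETE
   prevents anybody else from getting it for at most q (x k); so the agent who gets
   it has not been replaced yet and is again worse off than in (x, q). *)
Lemma fout_ge_walrasian n m (f : mechanism n m) R0 x q i : (m < n)%N -> desirable f ->
  walrasian_eq R0 x q -> util (R0 i) (x i) (q (x i)) <= uval (R0 i) (fout f R0 i).
Proof.
move=> mn df we; have [xal [[q0 qp] [dem _]]] := we.
(* The first clause makes [l] hold [x l] whenever it is as well off as with [x l] at [q]; the second
   keeps it from paying more than [q b] for another real object [b]. *)
pose fav l (P : cpref m) :=
  (forall b s, b <> x l -> 0 <= s -> util P b s < util P (x l) (q (x l))) /\
  (forall b s, b <> null -> b <> x l -> 0 <= util P b s -> s <= q b).
have [|d0 d00 d0P] := @finite_lower (obj m) (fun b d => b <> null -> d <= q b).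
  move=> b; have [->|b0] := EM (b = null); first by exists 1 => //; lra.
  by exists (q b) => [|d]; [exact: WE_price_pos we b0|lra].
suff main N S R' k : #|~: S| = N -> (forall j, j \notin S -> R' j = R0 j) ->
    (forall l, l \in S -> x l <> null /\ fav l (R' l)) -> k \notin S ->
    ~ uval (R0 k) (fout f R' k) < util (R0 k) (x k) (q (x k)).
  by apply: Rnot_lt_le; apply: (main _ set0 R0 i erefl) => // [l|]; rewrite inE.
elim: N S R' k => [|N IH] S R' k cS RS favS kS lt.
  by move/cards0_eq/setP/(_ k): cS; rewrite !inE kS.
have xk0 : x k <> null.
  move=> xk0; have := @fout_ir _ _ f R' k df; rewrite RS //.
  by move: lt; rewrite xk0 q0 util_null; lra.
(* Even [x k] for [q (x k) + e] would be a gain for [k]. So by strategy-proofness the new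
   preference, which accepts no higher payment, cannot bring it [x k]. *)
have [e e0 eP] : exists2 e, 0 < e &
    uval (R0 k) (fout f R' k) < util (R0 k) (x k) (q (x k) + e).
  have [|d dpos dP] := @util_cont _ (R0 k) (x k) (q (x k))
    (util (R0 k) (x k) (q (x k)) - uval (R0 k) (fout f R' k)); first lra.
  exists (d / 2); first lra.
  have /Rabs_def2 := dP (q (x k) + d / 2) ltac:(by apply: Rabs_def1; lra); lra.
have m0 := Rmin_pos (e / 2) d0 ltac:(lra) d00.
have ml := Rmin_l (e / 2) d0; have mr := Rmin_r (e / 2) d0.
set d := Rmin _ _ in m0 ml mr.
have [||P Pu] := @quasilinear m
  (fun b => if b == null then 0 else if b == x k then q (x k) + e else d).
- by rewrite eqxx.
- by move=> b /eqP/negbTE->; case: ifP => _ //; have := qp (x k); lra.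
have favP : fav k P.
  split=> b s; rewrite !Pu.
    move=> /eqP/negbTE bx s0; rewrite bx eqxx (negbTE (introN eqP xk0)).
    by case: ifP => _; lra.
  move=> b0 /eqP/negbTE ->; have := d0P d (conj m0 mr) b b0.
  by move/eqP/negbTE: b0 => ->; lra.
have Px s : util P (x k) s = q (x k) + e - s.
  by rewrite Pu eqxx (negbTE (introN eqP xk0)).
pose R2 := update R' k P.
have R2k : R2 k = P by exact: update_same.
have R2o j : j <> k -> R2 j = R' j by exact: update_other.
have kx : (fout f R2 k).1 <> x k.
  move=> kx; have := @fout_ir _ _ f R2 k df; have := @fout_sp _ _ f R' k P df.
  rewrite RS // -/R2 R2k /uval kx Px => h1 h2.
  have le : (fout f R2 k).2 <= q (x k) + e by lra.
  by have := util_le (R0 k) (x k) le; rewrite /uval in eP; lra.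
have [k' k'x] := fout_holder R2 df xk0.
have k'k : k' <> k by move=> h; rewrite h in k'x.
(* If [k'] pays at most [q (x k)], let it report [P] too: by equal treatment both [k] and [k'] would
   then hold [x k]. *)
have [le|gt] := Rle_or_lt (fout f R2 k').2 (q (x k)).
  pose R3 := update R2 k' P.
  have R3k' : R3 k' = P by rewrite /R3 update_same.
  have R3k : R3 k = P by rewrite /R3 update_other // => h; apply: k'k.
  have := @fout_sp_to _ _ f R2 k' P df; rewrite -/R3 {1}/uval k'x => h1.
  have h2 := util_le P (x k) le.
  have h3 := @fout_ete _ _ f R3 k' k df (etrans R3k' (esym R3k)).
  rewrite R3k' in h3.
  have get j : util P (x k) (q (x k)) <= uval P (fout f R3 j) -> (fout f R3 j).1 = x k.
    move=> h; apply: contrapT => hj; have := favP.1 _ _ hj (fout_pay R3 j df).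
    by rewrite /uval in h; lra.
  apply: k'k; apply: (alloc_inj (@fout_alloc _ _ f R3)).
    by rewrite get //; lra.
  by rewrite !get //; lra.
have k'S : k' \notin S.
  apply/negP => k'S; have [xk'0 [_ fv]] := favS _ k'S.
  have xx : x k <> x k'.
    by move=> xx; apply: k'k; apply: (alloc_inj xal); rewrite -?xx.
  have := fv (x k) (fout f R2 k').2 xk0 xx.
  have := @fout_ir _ _ f R2 k' df; rewrite R2o // /uval k'x => h1 h2.
  by have {}h2 := h2 h1; lra.
apply: (IH (k |: S) R2 k').
- by have := cardsD1 k (~: S); rewrite inE kS cS setCU setDE setIC => -[].
- by move=> j; rewrite in_setU1 negb_or => /andP[/eqP jk jS]; rewrite R2o // RS.
- move=> l; rewrite in_setU1 => /orP[/eqP->|lS]; first by rewrite R2k.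
  by rewrite R2o; [exact: favS|move=> lk; rewrite lk (negbTE kS) in lS].
- by rewrite in_setU1 negb_or k'S andbT; apply/eqP.
have /in_demandP/(_ (x k)) := dem k'; rewrite /uval k'x => h.
by have := util_lt (R0 k') (x k) gt; lra.
Qed.

Lemma fout_price_le n m (f : mechanism n m) R0 x q i : (m < n)%N -> desirable f ->
  walrasian_eq R0 x q -> (fout f R0 i).2 <= q (fout f R0 i).1.
Proof.
move=> mn df we; have := fout_ge_walrasian i mn df we.
have [_ [_ [dem _]]] := we; have /in_demandP/(_ (fout f R0 i).1) := dem i => h1 h2.
by apply: (@util_le_inv _ (R0 i) (fout f R0 i).1); rewrite /uval in h2; lra.
Qed.

Lemma fout_in_demand n m (f : mechanism n m) R0 x q i : (m < n)%N -> desirable f ->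
  walrasian_eq R0 x q -> q (fout f R0 i).1 <= (fout f R0 i).2 ->
  in_demand (prf R0 i) q (fout f R0 i).1.
Proof.
move=> mn df we h; have := fout_ge_walrasian i mn df we.
have [_ [_ [dem _]]] := we; rewrite /uval => h'; apply/in_demandP => b.
by have /in_demandP/(_ b) := dem i; have := util_le (R0 i) (fout f R0 i).1 h; lra.
Qed.

Lemma fout_walrasian n m (f : mechanism n m) R0 x q : desirable f ->
  walrasian_eq R0 x q -> (forall i, in_demand (prf R0 i) q (fout f R0 i).1) ->
  walrasian_eq R0 (fun i => (fout f R0 i).1) q.
Proof.
move=> df [_ [pq _]] dem; split; first exact: fout_alloc.
split => //; split => // a a0 ua; have [i xi] := fout_holder R0 df a0.
by case: (ua i).
Qed.

(** * Reduction of necessity to underpayment; sufficiency *)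

Lemma in_Zmin_no_underpayment n m (f : mechanism n m) R0 p : (m < n)%N -> desirable f ->
  tight R0 p -> (forall i, p (fout f R0 i).1 <= (fout f R0 i).2) ->
  in_Zmin R0 (proj1_sig (f R0)).
Proof.
move=> mn df tp h; have [x we] := tp.1.
exists p, (fun i => (fout f R0 i).1); split; first exact/min_WE_price_tight.
split; first by apply: (fout_walrasian df we) => i; exact: (fout_in_demand mn df we).
move=> i; rewrite -/(fout f R0 i).
have -> : p (fout f R0 i).1 = (fout f R0 i).2.
  by apply: Rle_antisym => //; exact: fout_price_le we.
by case: (fout f R0 i).
Qed.

(** Strategy-proofness rests on [tight_deviation]: what a misreport brings costs at least its price
    under truth-telling. No wastage holds because real objects have positive prices. *)
Lemma in_Zmin_desirable n m (f : mechanism n m) : (m < n)%N ->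
  (forall R0, in_Zmin R0 (proj1_sig (f R0))) -> desirable f.
Proof.
move=> mn Z.
have ZP R0 : exists p x, [/\ tight R0 p, walrasian_eq R0 x p &
    forall i, fout f R0 i = (x i, p (x i))].
  have [p [x [pm [we e]]]] := Z R0; exists p, x; split => //.
  exact/min_WE_price_tight.
split; [|split; [|split; [|split]]].
- move=> R0 i Ri'; have [p [x [tp we ->]]] := ZP R0.
  have [q [x' [_ we' ->]]] := ZP (update R0 i Ri').
  have le := tight_deviation tp we' (fun k => @update_other _ _ R0 i Ri' k).
  have [_ [_ [dem _]]] := we; have /in_demandP/(_ (x' i)) := dem i => h.
  by apply/utilP; have := util_le (R0 i) (x' i) le; lra.
- move=> R0 i; have [p [x [tp [_ [[p0 _] [dem _]]] ->]]] := ZP R0.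
  by rewrite -p0; exact: dem.
- move=> R0 i j Rij; have [p [x [tp [_ [_ [dem _]]] e]]] := ZP R0; rewrite !e.
  by split; [exact: dem|rewrite /prf Rij; exact: dem].
- move=> R0 a a0; have [p [x [tp we e]]] := ZP R0.
  apply: contrapT => nex; have := WE_price_pos mn we a0.
  have [_ [_ [_ ->]]] := we => //; first lra.
  by move=> i xi; apply: nex; exists i; rewrite e.
move=> R0 i; have [p [x [tp [_ [[_ pp] _]] ->]]] := ZP R0; exact: pp.
Qed.

(** * Preferences committed to two objects *)

(** At tight prices [c] will cost less than [K], so such an agent demands only [a] or [c]; the
    second clause serves to keep that price below [K]. *)
Definition wants m (K : R) (a c : obj m) (P : cpref m) : Prop :=
  (forall d s s', d <> a -> d <> c -> s < K -> 0 <= s' -> util P d s' < util P c s) /\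
  (forall d s, d <> c -> 0 <= util P d s -> s < K).

(** A steep utility between [t] and [v] puts [(a, t)] above everything else, even for free, however
    small [v - t] is. *)
Lemma wants_exists m K (a c : obj m) t v : 1 < K -> a <> null -> c <> null ->
  0 <= t < v -> v < K ->
  exists P, [/\ wants K a c P,
    forall d s, d <> a -> 0 <= s -> util P d s < util P a t &
    a <> c -> forall s, 0 <= util P a s -> s <= v].
Proof.
move=> K1 a0 c0 tv vK.
pose w d := if d == null then 0 else if d == c then K + 2 else if d == a then v else 1.
have w0 : w null = 0 by rewrite /w eqxx.
have wc : w c = K + 2 by rewrite /w (negbTE (introN eqP c0)) eqxx.
have wo d : d <> a -> d <> c -> w d <= 1.
  rewrite /w => /eqP/negbTE-> /eqP/negbTE->; case: ifP => _; lra.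
have wp d : d <> null -> 0 < w d.
  by rewrite /w => /eqP/negbTE->; case: ifP => _; [|case: ifP => _]; lra.
have [ac|ac] := EM (a = c).
  have [P Pu] := quasilinear w0 wp; exists P; split => //; rewrite -?ac in wc *; last first.
    by move=> d s da s0; have := wo d da; rewrite -ac !Pu wc => /(_ da); lra.
  split=> d s; first by move=> s' da dc sK s'0; rewrite !Pu wc; have := wo d da; rewrite -ac => /(_ da); lra.
  by move=> da; have := wo d da; rewrite -ac Pu => /(_ da); lra.
have wa : w a = v by rewrite /w (negbTE (introN eqP a0)) (negbTE (introN eqP ac)) eqxx.
(* This slope gives [(a, t)] utility at least [K + 3], above the [K + 2] of [c] for free. *)
pose lam d := if d == a then Rmax 1 ((K + 3) / (v - t)) else 1.
have lam1 d : 1 <= lam d by rewrite /lam; case: ifP => _; [exact: Rmax_l|lra].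
have lam0 : lam null = 1 by rewrite /lam (negbTE (introN eqP (nesym a0))).
have [P Pu] := kink_util w0 lam0 wp lam1.
have Po d s : d <> a -> util P d s = w d - s.
  by move=> /eqP/negbTE da; rewrite Pu /kink /lam /= da Rmax_left; lra.
have Pc s : util P c s = K + 2 - s by rewrite Po ?wc //; exact: nesym.
have Pa s : 0 <= util P a s -> s <= v.
  rewrite Pu /kink /= wa => h; apply: Rnot_lt_le => vs.
  suff : Rmax (lam a * (v - s)) (v - s) < 0 by lra.
  apply: Rmax_lub_lt; last lra.
  have : 0 < lam a * (s - v) by apply: Rmult_lt_0_compat; have := lam1 a; lra.
  lra.
exists P; split => //.
  split=> d s.
    by move=> s' da dc sK s'0; rewrite Po // Pc; have := wo d da dc; lra.
  move=> dc; have [->|da] := EM (d = a); first by move/Pa; lra.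
  by rewrite Po //; have := wo d da dc; lra.
move=> d s da s0; rewrite Po //.
have : K + 3 <= util P a t.
  rewrite Pu /kink /= wa; apply: Rle_trans (Rmax_l _ _).
  have -> : K + 3 = (K + 3) / (v - t) * (v - t) by field; lra.
  by apply: Rmult_le_compat_r; [lra|rewrite /lam eqxx; exact: Rmax_r].
have [->|dc] := EM (d = c); first lra.
by have := wo d da dc; lra.
Qed.

Lemma wants_choice m K (a c : obj m) P s z : wants K a c P -> s < K -> 0 <= z.2 ->
  util P c s <= uval P z -> z.1 = a \/ z.1 = c.
Proof.
move=> [w _] sK z2 h; apply: contrapT => /Decidable.not_or [za zc].
by have := w _ _ _ za zc sK z2; rewrite /uval in h; lra.
Qed.

(** [S] consists of the agents replaced so far, with their pairs [a l], [c l]. Injectivity of [c]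
    makes [l] the only agent who may be willing to pay [K] for [c l]. *)
Definition committed n m K (R0 : profile n m) (S : {set 'I_n}) (a c : 'I_n -> obj m) :=
  [/\ forall k, k \notin S -> wtp_lt K (R0 k),
      forall l, l \in S -> [/\ a l <> null, c l <> null & wants K (a l) (c l) (R0 l)] &
      {in S &, injective c}].

(** Tightness gives [c l] a demander other than [l], whose willingness to pay is below [K]. *)
Lemma committed_price n m K (R0 : profile n m) S a c p l : tight R0 p ->
  committed K R0 S a c -> l \in S -> p (c l) < K.
Proof.
move=> [[x [_ [[p0 _] _]]] tp] [bK wS cI] lS; have [_ cl0 _] := wS l lS.
have : (1 < #|demanders R0 p [set c l]|)%N.
  rewrite -(cards1 (c l)); apply: tp; first by apply/set0Pn; exists (c l); rewrite inE.
  by rewrite inE; apply/eqP; exact: nesym.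
rewrite (cardsD1 l) => h.
have /set0Pn[k] : demanders R0 p [set c l] :\ l != set0.
  by rewrite -card_gt0; case: (l \in _) h => /=; lia.
rewrite in_setD1 => /andP[/eqP kl /demandersP[b /set1P-> /in_demandP/(_ null)]].
rewrite p0 util_null Ropp_0; have [kS|/bK] := boolP (k \in S); last exact.
by have [_ _ [_ w]] := wS k kS; apply: w => ck; apply: kl; apply: cI.
Qed.

Lemma committed_demand n m K (R0 : profile n m) S a c p l d : tight R0 p ->
  committed K R0 S a c -> l \in S -> in_demand (prf R0 l) p d -> d = a l \/ d = c l.
Proof.
move=> tp co lS /in_demandP/(_ (c l)); have [_ wS _] := co; have [_ _ w] := wS l lS.
have [x [_ [[_ pp] _]]] := tp.1.
exact: (wants_choice (z := (d, p d)) w (committed_price tp co lS) (pp d)).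
Qed.

Lemma committed_fout n m K (f : mechanism n m) (R0 : profile n m) S a c l :
  (m < n)%N -> desirable f -> committed K R0 S a c -> l \in S ->
  (fout f R0 l).1 = a l \/ (fout f R0 l).1 = c l.
Proof.
move=> mn df co lS; have [p tp] := exists_tight R0 mn; have [x we] := tp.1.
have [_ wS _] := co; have [_ _ w] := wS l lS.
apply: (wants_choice w (committed_price tp co lS) (fout_pay R0 l df)).
have := fout_ge_walrasian l mn df we; have [_ [_ [dem _]]] := we.
by have /in_demandP/(_ (c l)) := dem l; lra.
Qed.

Lemma committed_fout_real n m K (f : mechanism n m) (R0 : profile n m) S a c l :
  (m < n)%N -> desirable f -> committed K R0 S a c -> l \in S -> (fout f R0 l).1 <> null.
Proof.
move=> mn df co lS; have [_ wS _] := co; have [al cl _] := wS l lS.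
by have [->|->] := committed_fout mn df co lS.
Qed.

(* Underpayment spreads by cloning: if i gets b for less than p b and l demands both
   b and b' at p, then, once i reports the preference of l, ETE makes i and l share
   b and b', both for less than p. An agent outside S demanding an underpaid object
   would, when cloned, give m.+1 agents a real object. So the underpaid objects are
   demanded by their own equilibrium holders only, contradicting tightness. *)
Lemma committed_all_pay n m K (f : mechanism n m) (R0 : profile n m) S a c p l0 :
  (m < n)%N -> desirable f -> committed K R0 S a c -> #|S| = m -> tight R0 p ->
  l0 \in S ->
  (forall d d', in_demand (prf R0 l0) p d -> in_demand (prf R0 l0) p d' -> d = d') ->
  ~ (fout f R0 l0).2 < p (fout f R0 l0).1.
Proof.
move=> mn df co Sm tp l0S sing under.
have [bK wS cI] := co; have [x [xal [[p0 pp] [dem _]]]] := tp.1.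
(* [s] tells whose preference each agent reports, except that the report of [i], who stands for
   [l0], is free. *)
pose under_at b := exists R' i (s : {perm 'I_n}), [/\ s i = l0, forall k, k \notin S -> s k = k,
  forall k, k <> i -> R' k = R0 (s k), (fout f R' i).1 = b & (fout f R' i).2 < p b].
have in_S (s : {perm 'I_n}) : (forall k, k \notin S -> s k = k) -> forall k, s k \in S -> k \in S.
  by move=> sS k skS; apply: contraT => kS; rewrite sS in skS; rewrite ?skS in kS.
have tie b b' l1 : under_at b -> l1 \in S -> l1 <> l0 -> b <> b' ->
    in_demand (prf R0 l1) p b -> in_demand (prf R0 l1) p b' -> under_at b'.
  move=> [R' [i [s [si sS R's yb yp]]]] l1S l10 bb' db db'.
  pose k := (s^-1)%g l1; have sk : s k = l1 by rewrite permKV.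
  have ki : k <> i by move=> ki; apply: l10; rewrite -sk ki.
  have iS : i \in S by apply: (in_S s sS); rewrite si.
  have kS : k \in S by apply: (in_S s sS); rewrite sk.
  pose R2 := update R' i (R0 l1).
  have R2i : R2 i = R0 l1 by exact: update_same.
  have R2k : R2 k = R0 l1 by rewrite /R2 update_other // R's // sk.
  have h1 := @fout_sp_to _ _ f R' i (R0 l1) df; rewrite -/R2 {1}/uval yb in h1.
  have h2 := util_lt (R0 l1) b yp.
  have h3 := @fout_ete _ _ f R2 i k df (etrans R2i (esym R2k)); rewrite R2i in h3.
  have pc := committed_price tp co l1S; have [_ _ w] := wS _ l1S.
  have both j : j = i \/ j = k -> util (R0 l1) b (p b) < uval (R0 l1) (fout f R2 j).
    by case=> ->; lra.
  have dbb := committed_demand tp co l1S db; have dbb' := committed_demand tp co l1S db'.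
  have obj j : j = i \/ j = k -> (fout f R2 j).1 = b \/ (fout f R2 j).1 = b'.
    move=> /both h; have /in_demandP/(_ (c l1)) h' := db.
    have hc : util (R0 l1) (c l1) (p (c l1)) <= uval (R0 l1) (fout f R2 j) by lra.
    have oj := wants_choice w pc (fout_pay R2 j df) hc.
    by case: oj => ->; case: dbb dbb' bb' => -> [] -> ne; by [left|right|case: ne].
  have pay j : j = i \/ j = k -> (fout f R2 j).1 = b' -> (fout f R2 j).2 < p b'.
    move=> /both; rewrite /uval => h e; rewrite e in h; apply: (@util_lt_inv _ (R0 l1) b').
    by have /in_demandP/(_ b') := db; lra.
  have [yi|yi] := EM ((fout f R2 i).1 = b').
    exists R2, i, s; split => //; last by apply: pay => //; left.
    by move=> k' k'i; rewrite /R2 update_other // R's.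
  have yk : (fout f R2 k).1 = b'.
    have yib : (fout f R2 i).1 = b by case: (obj i) => //; left.
    case: (obj k) => //; first by right.
    move=> ykb; case: ki; apply: (alloc_inj (@fout_alloc _ _ f R2)); rewrite ykb //.
    by have [al cl _] := wS _ l1S; case: dbb => ->.
  (* When [k] is the one who gets [b'], the free report passes to [k], while [i] keeps the
     preference of [l1]; hence the transposition. *)
  exists R2, k, (tperm i k * s)%g; split => //; last by apply: pay => //; right.
  - by rewrite permM tpermR.
  - move=> k' k'S; rewrite permM tpermD ?sS //.
      by apply/eqP => ik'; rewrite -ik' iS in k'S.
    by apply/eqP => kk'; rewrite -kk' kS in k'S.
  move=> k' k'k; rewrite permM; have [->|k'i] := EM (k' = i); first by rewrite tpermL sk.
  rewrite tpermD; [|by apply/eqP; exact: nesym|by apply/eqP; exact: nesym].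
  by rewrite /R2 update_other // R's.
have out b k : under_at b -> k \notin S -> ~ in_demand (prf R0 k) p b.
  move=> [R' [i [s [si sS R's yb yp]]]] kS db.
  have iS : i \in S by apply: (in_S s sS); rewrite si.
  have ki : k <> i by move=> ki; rewrite ki iS in kS.
  pose R2 := update R' i (R0 k).
  have R2i : R2 i = R0 k by exact: update_same.
  have R2k : R2 k = R0 k by rewrite /R2 update_other // R's // sS.
  have h1 := @fout_sp_to _ _ f R' i (R0 k) df; rewrite -/R2 {1}/uval yb in h1.
  have h2 := util_lt (R0 k) b yp.
  have h3 := @fout_ete _ _ f R2 i k df (etrans R2i (esym R2k)); rewrite R2i in h3.
  have /in_demandP/(_ null) := db; rewrite p0 util_null => h4.
  have real j : j = i \/ j = k -> (fout f R2 j).1 <> null.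
    by move=> ej; apply: (@uval_pos_real _ (R0 k) _ (fout_pay R2 j df)); case: ej => ->; lra.
  have sSS l : l \in S -> s l \in S.
    move=> lS; apply: contraT => slS; have := sS _ slS => /perm_inj e.
    by rewrite e lS in slS.
  (* The agents of [S] other than [i] stay committed and get real objects; with [i] and [k] this
     makes [m.+1] agents. *)
  have co2 : committed K R2 (S :\ i) (fun l => a (s l)) (fun l => c (s l)).
    split.
    - move=> k'; have [->|k'i] := EM (k' = i); first by rewrite R2i => _; exact: bK.
      rewrite in_setD1 (introN eqP k'i) /= => k'S.
      by rewrite /R2 update_other // R's // sS //; exact: bK.
    - move=> l; rewrite in_setD1 => /andP[/eqP li lS].
      by rewrite /R2 update_other // R's //; apply: wS; exact: sSS.
    move=> l l'; rewrite !in_setD1 => /andP[_ lS] /andP[_ l'S] e.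
    by apply: (@perm_inj _ s); apply: cI e; exact: sSS.
  have [|l] := @alloc_null _ _ _ (k |: S) (@fout_alloc _ _ f R2).
    by rewrite cardsU1 kS Sm add1n.
  have [->|li] := EM (l = i); first by move=> _; apply: real; left.
  rewrite in_setU1 => /orP[/eqP->|lS]; first by apply: real; right.
  by apply: (committed_fout_real mn df co2); rewrite in_setD1 lS andbT; apply/eqP.
pose Z := [set b | `[< under_at b >]].
have ZP b : reflect (under_at b) (b \in Z) by rewrite inE; apply: asboolP.
have Z0 : null \notin Z.
  apply/ZP => -[R' [i [s [_ _ _ _]]]]; rewrite p0.
  by have := fout_pay R' i df; lra.
have : (#|Z| < #|demanders R0 p Z|)%N.
  apply: tp.2 => //; apply/set0Pn; exists (fout f R0 l0).1; apply/ZP.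
  by exists R0, l0, 1%g; split => // [|k|k _]; rewrite perm1.
apply/negP; rewrite -leqNgt; apply: (alloc_card xal Z0) => k /demandersP[b /ZP ub db].
have [kS|kS] := boolP (k \in S); last by case: (out b k).
have [e|kl0] := EM (k = l0).
  by apply/ZP; rewrite (sing (x k) b) //; rewrite -?e //; exact: dem.
have [e|ne] := EM (b = x k); first by apply/ZP; rewrite -e.
by apply/ZP; apply: (tie b (x k) k).
Qed.

(* The edges a l -> c l form a forest, in which d increases away from the roots. The
   new edge from b goes to the root r of another tree. *)
Lemma fresh_root n m (S : {set 'I_n}) (a c : 'I_n -> obj m) (d : obj m -> nat) b :
  {in S &, injective c} -> (forall l, l \in S -> c l <> null) ->
  (forall l, l \in S -> (d (a l) < d (c l))%N) -> (#|S|.+1 < m)%N ->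
  exists r d', [/\ r <> null, forall l, l \in S -> c l <> r, (d' b < d' r)%N &
    forall l, l \in S -> (d' (a l) < d' (c l))%N].
Proof.
move=> cI c0 ac Sm.
(* [par] follows the edge entering [z] backwards and fixes the roots. The orbit of [b] meets at most
   one root, while [U] contains two. *)
pose par z := if [pick l in S | c l == z] is Some l then a l else z.
have par_c l : l \in S -> par (c l) = a l.
  move=> lS; rewrite /par; case: pickP => [l' /andP[l'S /eqP/cI-> //]|/(_ l)].
  by rewrite lS eqxx.
have par_root z : (forall l, l \in S -> c l <> z) -> par z = z.
  move=> zr; rewrite /par; case: pickP => // l /andP[lS /eqP e].
  by case: (zr l).
pose U := [set~ null] :\: (c @: S).
have Ur r : r \in U -> r <> null /\ forall l, l \in S -> c l <> r.
  rewrite !inE => /andP[rc /eqP r0]; split => // l lS e.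
  by case/imsetP: rc; exists l.
have U2 : (1 < #|U|)%N.
  have cS : #|c @: S| = #|S| by rewrite card_in_imset.
  rewrite cardsD cardsC1 card_ord /= (setIidPr _) ?cS; first lia.
  by apply/subsetP => _ /imsetP[l lS ->]; rewrite !inE; apply/eqP; exact: c0.
have [r rU rb] : exists2 r, r \in U & ~~ fconnect par b r.
  apply: contrapT => nex.
  have conn r : r \in U -> fconnect par b r.
    by move=> rU; apply: contraT => nc; case: nex; exists r.
  have /card_gt1P[r1 [r2 [r1U r2U r12]]] := U2.
  have fix_ r k : r \in U -> iter k par r = r.
    by move=> /Ur[_ rr]; elim: k => //= k ->; exact: par_root.
  move/eqP: r12; case: (iter_findex (conn _ r1U)) (iter_findex (conn _ r2U)).
  move: (findex _ _ r1) (findex _ _ r2) => i j e1 e2; case.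
  have [ij|/ltnW ji] := leqP i j.
    by rewrite -e2 -(subnK ij) iterD e1 fix_.
  by rewrite -e1 -(subnK ji) iterD e2 fix_.
have [r0 rS] := Ur r rU.
(* Raising [d] off the ancestors of [b] lifts [r] above [b] and spoils no edge, as the parent of an
   ancestor is an ancestor. *)
exists r, (fun z => if fconnect par b z then d z else (d z + (d b).+1)%N); split => //.
  by rewrite connect0 (negbTE rb); lia.
move=> l lS; have := ac l lS; have [cb|cb] := boolP (fconnect par b (c l)).
  have -> : fconnect par b (a l) by apply: connect_trans cb _; rewrite -(par_c l lS) fconnect1.
  by [].
by case: ifP => _; lia.
Qed.

Lemma connect_ind (T : finType) (e : rel T) (P : T -> Prop) x :
  P x -> (forall y z, P y -> e y z -> P z) -> forall y, connect e x y -> P y.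
Proof.
move=> Px Pe y /connectP[s]; elim: s x Px => [|z s IH] x Px /=; first by move=> _ ->.
by move=> /andP[xz zs]; apply: IH zs; exact: Pe xz.
Qed.

(* l0 does not demand what it gets from f. Follow l -> the f-holder of x l, starting
   from l0. As the edges {a l, c l} form a forest, this chain leaves S; the agents
   before that point demand only their x l, so its last agent can raise a price. *)
Lemma committed_chain n m K (f : mechanism n m) (R0 : profile n m) S a c (d : obj m -> nat) p l0 :
  (m < n)%N -> desirable f -> committed K R0 S a c ->
  (forall l, l \in S -> (d (a l) < d (c l))%N) -> tight R0 p -> l0 \in S ->
  ~ in_demand (prf R0 l0) p (fout f R0 l0).1 ->
  exists j Rj q, [/\ j \notin S, (fout f R0 j).1 <> null, tight (update R0 j Rj) q &
    p (fout f R0 j).1 < q (fout f R0 j).1].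
Proof.
move=> mn df co ac tp l0S nl0; have [bK wS cI] := co.
have [x [xal [pq [dem _]]]] := tp.1.
pose y l := (fout f R0 l).1.
have yac l : l \in S -> y l = a l \/ y l = c l by move=> lS; exact: committed_fout co lS.
have dac l b : l \in S -> in_demand (prf R0 l) p b -> b = a l \/ b = c l.
  by move=> lS; exact: committed_demand tp co lS.
have x0 l : l \in S -> x l <> null.
  by move=> lS; have [al cl _] := wS l lS; case: (dac l (x l) lS (dem l)) => ->.
pose e l l' := (l' \in S) && (y l' == x l).
pose Y := [set l | connect e l0 l].
have YP l : l \in Y -> [/\ l \in S, x l <> y l & l = l0 \/ exists2 l', l' \in Y & y l = x l'].
  rewrite inE => h; suff [_ ? ? ?] : [/\ connect e l0 l, l \in S, x l <> y l
    & l = l0 \/ exists2 l', l' \in Y & y l = x l'] by [].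
  move: l h; apply: connect_ind; first split => //; [|by left|].
    by move=> xy; apply: nl0; rewrite -/(y l0) -xy; exact: dem.
  move=> l l' [cl lS xyl _] ell'; have /andP[l'S /eqP yl'] := ell'; split => //.
  - by apply: connect_trans cl _; exact: connect1.
  - rewrite yl' => xx; have ll' : l = l'.
      by apply: (alloc_inj xal); [exact: x0|exact: esym].
    by apply: xyl; rewrite ll' yl' ll'.
  by right; exists l; rewrite ?inE.
have YS l : l \in Y -> l \in S by case/YP.
have acxy l b : l \in Y -> b = a l \/ b = c l -> b = x l \/ b = y l.
  move=> lY; have [lS xy _] := YP l lY.
  case: (yac l lS) (dac l (x l) lS (dem l)) => e1 [] e2 [] ->;
    by [left|right|case: xy; rewrite e1 e2].
have dY l b : l \in Y -> in_demand (prf R0 l) p b -> b \in x @: Y.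
  move=> lY db; have [lS xy yl] := YP l lY.
  have [->|by_] := acxy l b lY (dac l b lS db); first exact: imset_f.
  case: yl => [ll0|[l' l'Y yl']]; last by rewrite by_ yl'; exact: imset_f.
  by case: nl0; rewrite -/(y l0) -ll0 -by_.
have xYc : #|x @: Y| = #|Y|.
  rewrite card_in_imset // => l l' lY l'Y; apply: (alloc_inj xal).
  by apply: x0; exact: YS.
(* Otherwise [x], [y] and [c] would have the same image on [Y]. The [a l] with least [d] would then
   be some [c l'], and [a l'] would lie lower still. *)
have [l lY hold] : exists2 l, l \in Y & forall l', l' \in S -> y l' <> x l.
  apply: contrapT => nex.
  have xy : x @: Y \subset y @: Y.
    apply/subsetP => _ /imsetP[l lY ->]; apply: contrapT => ny; apply: nex.
    exists l => // l' l'S yl'; apply: ny; apply/imsetP; exists l' => //.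
    rewrite inE; rewrite inE in lY; apply: connect_trans lY (connect1 _).
    by rewrite /e l'S; apply/eqP.
  have xyE : x @: Y = y @: Y.
    by apply/eqP; rewrite eqEcard xy xYc leq_imset_card.
  have cx : c @: Y = x @: Y.
    apply/eqP; rewrite eqEcard xYc card_in_imset ?leqnn ?andbT.
      apply/subsetP => _ /imsetP[l lY ->].
      by have [->|->] := acxy l (c l) lY (or_intror erefl); [|rewrite xyE]; exact: imset_f.
    by move=> l l' /YS lS /YS l'S; exact: cI.
  have l0Y : l0 \in Y by rewrite inE connect0.
  case: (arg_minnP (fun l => d (a l)) l0Y) => l lY lmin.
  have : a l \in c @: Y.
    rewrite cx; have [->|->] := acxy l (a l) lY (or_introl erefl); [|rewrite xyE]; exact: imset_f.
  case/imsetP => l' l'Y e'; have := lmin l' l'Y; have := ac l' (YS _ l'Y).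
  by rewrite e'; lia.
have xl0 := x0 l (YS _ lY).
have [j yj] := fout_holder R0 df xl0.
have jS : j \notin S by apply/negP => /hold; apply.
(* By [dY] the agents of [Y] demand only the [#|Y|] objects of [x @: Y], one of which [j] gets from
   [f]. *)
have [|||||Rj [q [tq pq']]] := @hall_price_rise _ _ R0 p j (x l) Y (x @: Y) mn tp.
- by apply/imsetP => -[l' l'Y]; have := x0 l' (YS _ l'Y) => h e'; apply: h.
- exact: imset_f.
- by apply/negP => /YS; rewrite (negbTE jS).
- by move=> l' b; exact: dY.
- by rewrite xYc.
by exists j, Rj, q; rewrite yj.
Qed.

(** * Nobody underpays *)

(** By strategy-proofness [h] still gets [b], for at most its old payment. In an equilibrium giving
    [b] to [h], [tight_deviation] puts its price at [q b] or more. This is unacceptable to [h] if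
    [b <> r]; if [b = r], then [h] demands only [b] and so underpays. *)
Lemma commit_agent n m K (f : mechanism n m) R0 (S : {set 'I_n}) a c h Rh q r
    (b := (fout f R0 h).1) (a' := fun l => if l == h then b else a l)
    (c' := fun l => if l == h then r else c l) :
  (m < n)%N -> 1 < K -> desirable f -> committed K R0 S a c -> h \notin S ->
  b <> null -> r <> null -> (forall l, l \in S -> c l <> r) ->
  tight (update R0 h Rh) q -> (fout f R0 h).2 < q b ->
  exists P (R1 := update R0 h P), [/\ committed K R1 (h |: S) a' c',
    b <> r -> forall x p, walrasian_eq R1 x p ->
      ~ forall i, in_demand (prf R1 i) p (fout f R1 i).1 &
    b = r -> forall p, tight R1 p -> (fout f R1 h).2 < p (fout f R1 h).1].
Proof.
move=> mn K1 df co hS b0 r0 cr tq under; have [bK wS cI] := co.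
set t := (fout f R0 h).2 in under.
have t0 : 0 <= t := fout_pay R0 h df.
have tK : t < K by apply: (bK h hS b); exact: fout_ir.
have [v [tv vq vK]] : exists v, [/\ t < v, v < q b & v < K].
  have qm : 0 < Rmin (q b - t) (K - t) by apply: Rmin_pos; lra.
  have := Rmin_l (q b - t) (K - t); have := Rmin_r (q b - t) (K - t) => h1 h2.
  by exists (t + Rmin (q b - t) (K - t) / 2); split; lra.
have [P [wP Pb Pv]] := wants_exists K1 b0 r0 (conj t0 tv) vK.
exists P => R1.
have R1h : R1 h = P by exact: update_same.
have R1o k : k <> h -> R1 k = R0 k by exact: update_other.
have Sh l : l \in S -> l <> h by move=> lS lh; rewrite -lh lS in hS.
have co1 : committed K R1 (h |: S) a' c'.
  split.
  - move=> k; rewrite in_setU1 negb_or => /andP[/eqP kh kS].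
    by rewrite R1o //; exact: bK.
  - move=> l; rewrite in_setU1 /a' /c'; case: eqP => [-> _|lh /= lS]; first by rewrite R1h.
    by rewrite R1o //; exact: wS.
  move=> l l'; rewrite !in_setU1 /c'; case: eqP => [->|_]; case: eqP => [->|_] //=.
  - by move=> _ /cr h' /esym.
  - by move=> /cr.
  by move=> lS l'S; exact: cI.
have sp := @fout_sp_to _ _ f R0 h P df; rewrite -/R1 {1}/uval -/b -/t in sp.
have yb : (fout f R1 h).1 = b.
  apply: contrapT => ny; have := Pb _ (fout f R1 h).2 ny (fout_pay R1 h df).
  by rewrite /uval in sp; lra.
have yt : (fout f R1 h).2 <= t.
  by apply: (@util_le_inv _ P b); rewrite /uval yb in sp; lra.
have dev x p : walrasian_eq R1 x p -> x h = b -> q b <= p b.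
  move=> we <-; apply: (tight_deviation tq we) => k kh.
  by rewrite R1o // update_other.
split => // [br x p we dem|br p tp]; last first.
  have [x we] := tp.1; rewrite yb; suff : x h = b by move/(dev _ _ we); lra.
  have [_ [_ [dem _]]] := we.
  have := committed_demand tp co1 (setU11 h S) (dem h).
  by rewrite /a' /c' eqxx -br => -[].
have := dev _ _ (fout_walrasian df we dem) yb.
have := dem h; rewrite yb => /in_demandP/(_ null).
have [_ [[p0 _] _]] := we; rewrite p0 util_null R1h Ropp_0 => /(Pv br); lra.
Qed.

(** Induction on the number [N.+1] of replacements left. Underpayment is measured against tight
    prices after a misreport of [h], the form in which [committed_chain] delivers the next agent. *)
Lemma no_outside_underpayment n m K (f : mechanism n m) (N : nat) R0 (S : {set 'I_n})
    a c d h Rh q :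
  (m < n)%N -> 1 < K -> desirable f -> (#|S| + N.+1)%N = m -> committed K R0 S a c ->
  (forall l, l \in S -> (d (a l) < d (c l))%N) -> h \notin S ->
  (fout f R0 h).1 <> null -> tight (update R0 h Rh) q ->
  ~ (fout f R0 h).2 < q (fout f R0 h).1.
Proof.
move=> mn K1 df; elim: N R0 S a c d h Rh q => [|N IH] R0 S a c d h Rh q Sm co ac hS b0 tq under.
  have cS : (#|c @: S| < #|[set~ null : obj m]|)%N.
    rewrite cardsC1 card_ord /=; apply: leq_ltn_trans (leq_imset_card c _) _.
    by have := leqnn m; rewrite -{1}Sm addn1.
  have [r r0 rS] : exists2 r, r <> null & forall l, l \in S -> c l <> r.
    have [r] : exists r, r \in [set~ null : obj m] :\: (c @: S).
      apply/set0Pn; rewrite setD_eq0; apply/negP => /subset_leq_card.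
      by rewrite leqNgt cS.
    rewrite !inE => /andP[rc /eqP r0]; exists r => // l lS e.
    by case/imsetP: rc; exists l.
  have [_ wS _] := co.
  have [P [co1 ne eq]] := commit_agent mn K1 df co hS b0 r0 rS tq under.
  move: co1 ne eq; set R1 := update R0 h P; set S1 := h |: S => co1 ne eq.
  have S1m : #|S1| = m by rewrite /S1 cardsU1 hS; lia.
  have [p tp] := exists_tight R1 mn; have [x we] := tp.1.
  have [br|br] := EM ((fout f R0 h).1 = r).
    apply: (committed_all_pay mn df co1 S1m tp (setU11 h S) _ (eq br p tp)) => u u' du du'.
    have := committed_demand tp co1 (setU11 h S) du.
    have := committed_demand tp co1 (setU11 h S) du'.
    by rewrite eqxx -br => -[] -> [] ->.
  (* Such an [l0] underpays. It lies in [S1], whose [m] agents hold all real objects, and not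
     demanding the one of its two objects that it gets, it demands only the other. *)
  have [l0 nl0] : exists l0, ~ in_demand (prf R1 l0) p (fout f R1 l0).1.
    by apply/existsNP => dem; exact: (ne br x p we).
  have under0 : (fout f R1 l0).2 < p (fout f R1 l0).1.
    apply: Rnot_le_lt => le; apply: nl0; exact: (fout_in_demand mn df we).
  have l0S : l0 \in S1.
    apply: contraT => l0S.
    have [|l] := @alloc_null _ _ _ (l0 |: S1) (@fout_alloc _ _ f R1).
      by rewrite cardsU1 l0S S1m add1n.
    rewrite in_setU1 => /orP[/eqP-> y0|lS1 y0].
      have [_ [[p0 _] _]] := we; rewrite y0 p0 in under0.
      by have := fout_pay R1 l0 df; lra.
    by case: (committed_fout_real mn df co1 lS1).
  apply: (committed_all_pay mn df co1 S1m tp l0S _ under0) => u u' du du'.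
  have uy w : in_demand (prf R1 l0) p w -> w <> (fout f R1 l0).1 by move=> dw e; apply: nl0; rewrite -e.
  have := uy _ du; have := uy _ du'.
  have := committed_demand tp co1 l0S du; have := committed_demand tp co1 l0S du'.
  by have := committed_fout mn df co1 l0S => -[] -> [] -> [] ->.
have cI : {in S &, injective c} by case: co.
have [|r [d' [r0 rS dr ac']]] := @fresh_root _ _ S a c d (fout f R0 h).1 cI _ ac ltac:(lia).
  by case: co => _ wS _ l /wS[].
have [P [co1 ne _]] := commit_agent mn K1 df co hS b0 r0 rS tq under.
move: co1 ne; set R1 := update R0 h P; set S1 := h |: S => co1 ne.
have S1m : (#|S1| + N.+1)%N = m by rewrite /S1 cardsU1 hS; lia.
have [p tp] := exists_tight R1 mn; have [x we] := tp.1.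
have br : (fout f R0 h).1 <> r by move=> br; rewrite br ltnn in dr.
have ac1 l : l \in S1 -> (d' (if l == h then (fout f R0 h).1 else a l)
    < d' (if l == h then r else c l))%N.
  by rewrite in_setU1; case: eqP => // _ /= lS; exact: ac'.
have [l0 nl0] : exists l0, ~ in_demand (prf R1 l0) p (fout f R1 l0).1.
  by apply/existsNP => dem; exact: (ne br x p we).
have under0 : (fout f R1 l0).2 < p (fout f R1 l0).1.
  apply: Rnot_le_lt => le; apply: nl0; exact: (fout_in_demand mn df we).
(* From an underpayer in [S1] the chain leads to an outsider [j]; an underpayer outside [S1] is used
   directly, with its own preference as the misreport. *)
have [l0S|l0S] := boolP (l0 \in S1).
  have [j [Rj [q' [jS yj tq' pq']]]] := committed_chain mn df co1 ac1 tp l0S nl0.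
  apply: (IH _ _ _ _ d' j Rj q' S1m co1 ac1 jS yj tq').
  by have := fout_price_le j mn df we; lra.
apply: (IH _ _ _ _ d' l0 (R1 l0) p S1m co1 ac1 l0S _ _ under0); last by rewrite update_id.
move=> y0; have [_ [[p0 _] _]] := we; rewrite y0 p0 in under0.
by have := fout_pay R1 l0 df; lra.
Qed.

Theorem theorem1 (n m : nat) (Hm : (2 <= m)%N) (Hnm : (m < n)%N) (f : mechanism n m) :
  (strategy_proof f /\ individually_rational f /\ equal_treatment f /\
   no_wastage f /\ no_subsidy f)
  <-> (forall R0 : profile n m, in_Zmin R0 (proj1_sig (f R0))).
Proof.
split=> [df R0|]; last exact: in_Zmin_desirable.
have [p tp] := exists_tight R0 Hnm; apply: (in_Zmin_no_underpayment Hnm df tp) => h.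
apply: Rnot_lt_le => under; have [x [_ [[p0 _] _]]] := tp.1.
have [K K1 bK] := profile_wtp_lt R0.
have co : committed K R0 set0 (fun=> null) (fun=> null).
  by split=> [k _|l|l l']; [exact: bK|rewrite inE|rewrite inE].
(* The start is the empty forest, and the trivial misreport [R0 h] lets [p] serve as the prices
   after deviation. *)
apply: (@no_outside_underpayment n m K f m.-1 R0 set0 (fun=> null) (fun=> null)
  (fun=> 0%N) h (R0 h) p Hnm K1 df _ co) => //.
- by rewrite cards0; lia.
- by move=> l; rewrite inE.
- by rewrite inE.
- by move=> y0; rewrite y0 p0 in under; have := fout_pay R0 h df; lra.
by rewrite update_id.
Qed.
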